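(* Let $L=L(\kappa,\kappa_1,\dots,\kappa_n)$ be a smooth function of finitely many arguments, and consider the $SE(2)$-invariant variational problem $\int L(\kappa,\kappa_s,\kappa_{ss},\dots)\,\mathrm{d}s$ for smooth planar curves, where $s$ is Euclidean arc length and $\kappa$ is Euclidean curvature. Put $$\lambda(s)=-L+\sum_{m\ge 1}\sum_{j=0}^{m-1}(-1)^j\mathcal{D}_s^j\left(\frac{\partial L}{\partial\kappa_m}\right)\kappa_{m-j}.$$ Then the invariantized Euler--Lagrange equation of the variational problem for a curve $(x(s),y(s))$ parametrized by arc length is $$\mathcal{D}_s^2\mathsf{E}^\kappa(L)+\kappa^2\mathsf{E}^\kappa(L)-\kappa\left(L-\sum_{m\ge 1}\sum_{j=0}^{m-1}(-1)^j\mathcal{D}_s^j\left(\frac{\partial L}{\partial\kappa_m}\right)\kappa_{m-j}\right)=0,$$ and along every extremal curve $(x(s),y(s))$ Noether's conservation laws associated with the $SE(2)$-invariance are $$\begin{pmatrix}x_s&-y_s&0\\ y_s&x_s&0\\ xy_s-yx_s&xx_s+yy_s&1\end{pmatrix}\begin{pmatrix}-\lambda(s)-\kappa\mathsf{E}^\kappa(L)\\-\mathcal{D}_s\mathsf{E}^\kappa(L)\\ \mathsf{E}^\kappa(L)\end{pmatrix}=\mathbf{c},$$ where $\mathbf{c}=(c_1,c_2,c_3)^T$ is a constant vector (independent of $s$).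
   Context: Curves are smooth planar curves $(x(s),y(s))$ with $x_s^2+y_s^2=1$; subscripts $s$ denote derivatives in $s$, and $\mathcal{D}_s=\mathrm{d}/\mathrm{d}s$ is the total derivative. The (signed) Euclidean curvature is $\kappa=x_sy_{ss}-y_sx_{ss}$, and $\kappa_m=\partial^m\kappa/\partial s^m$ ($\kappa_0=\kappa$). The Euler operator is $\mathsf{E}^\kappa(L)=\sum_{m\ge 0}(-1)^m\mathcal{D}_s^m\left(\partial L/\partial\kappa_m\right)$. All expressions in $L$ are evaluated along the curve. The group $SE(2)$ acts on the plane by rotations and translations. An extremal curve is a curve that is a critical point of the functional $\int L(\kappa,\kappa_s,\kappa_{ss},\dots)\,\mathrm{d}s$ under all smooth compactly supported variations of the curve, where for each varied curve $\mathrm{d}s$, $\partial_s$ and $\kappa$ denote arc length, arc-length derivative and curvature of that varied curve. *)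

(* Defs.v *)
From HB Require Import structures.
From mathcomp Require Import all_boot all_order all_algebra.
From mathcomp Require Import all_classical all_reals all_analysis.
Import Order.TTheory GRing.Theory Num.Theory.
Import numFieldNormedType.Exports.

Set Implicit Arguments.
Unset Strict Implicit.
Unset Printing Implicit Defensive.

Local Open Scope classical_set_scope.
Local Open Scope ring_scope.

(** * Smoothness on an open set *)

(* All iterated directional derivatives of order at most [k] exist and are
   continuous on [U]. Only meaningful for [U] open; on a finite-dimensional
   [V] this is the usual class C^k. *)
Fixpoint Ck_on (R : realType) (V : normedModType R) (U : set V) (k : nat)
    (f : V -> R) : Prop :=
  (forall a, U a -> {for a, continuous f}) /\
  match k with
  | 0 => True
  | k'.+1 => (forall v a, U a -> derivable f a v) /\
             (forall v, Ck_on U k' ('D_v f))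
  end.

Definition smooth_on (R : realType) (V : normedModType R) (U : set V)
    (f : V -> R) : Prop := forall k, Ck_on U k f.

(** * Euclidean geometry of a parametrized plane curve

   The parameter need not be arc length: the curves obtained by varying an
   arc-length parametrized curve in general no longer have unit speed. *)

Definition speed (R : realType) (x y : R -> R) (u : R) : R :=
  Num.sqrt (derive1 x u ^+ 2 + derive1 y u ^+ 2).

(* On a unit speed curve this is [derive1 f]. *)
Definition Ds (R : realType) (x y f : R -> R) : R -> R :=
  fun u => derive1 f u / speed x y u.

Definition curvature (R : realType) (x y : R -> R) : R -> R :=
  fun u => Ds x y x u * Ds x y (Ds x y y) u - Ds x y y u * Ds x y (Ds x y x) u.

Definition kappa (R : realType) (x y : R -> R) (m : nat) : R -> R :=
  iter m (Ds x y) (curvature x y).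

Definition kappa_jet (R : realType) (n : nat) (x y : R -> R) (u : R)
    : 'rV[R]_n.+1 :=
  \row_(m < n.+1) kappa x y m u.

(** * The variational problem *)

(* The functional restricted to the parameter range [[p, q]]. *)
Definition action (R : realType) (n : nat) (L : 'rV[R]_n.+1 -> R) (p q : R)
    (x y : R -> R) : R :=
  \int[lebesgue_measure]_(u in `[p, q])
    (L (kappa_jet n x y u) * speed x y u).

(* [X (u, e)] is a smooth deformation of [x], defined for [u] in [I] and
   [`|e| < d], which moves only points with parameter in [[p, q]]. *)
Definition compact_variation (R : realType) (I : set R) (p q d : R)
    (x : R -> R) (X : (R * R)%type -> R) : Prop :=
  [/\ smooth_on (I `*` [set e : R | `|e| < d]) X,
      (forall u, I u -> X (u, 0) = x u) &
      (forall u e, I u -> ~ `[p, q]%classic u -> `|e| < d -> X (u, e) = x u)].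

(* The integral over all of [I] may diverge. A variation supported in [[p, q]]
   changes only the part of the integral over [[p, q]], so criticality is
   tested there. *)
Definition extremal (R : realType) (n : nat) (L : 'rV[R]_n.+1 -> R) (I : set R)
    (x y : R -> R) : Prop :=
  forall (p q d : R) (X Y : (R * R)%type -> R),
    `[p, q] `<=` I -> 0 < d ->
    compact_variation I p q d x X -> compact_variation I p q d y Y ->
    is_derive (0 : R) (1 : R)
      (fun e : R => action L p q (fun u => X (u, e)) (fun u => Y (u, e)))
      (0 : R).

(** * Euler operator and Euler--Lagrange expression *)

(* The partial derivative of [L] in its [m]-th argument, along the curve. *)
Definition dL (R : realType) (n : nat) (L : 'rV[R]_n.+1 -> R) (x y : R -> R)
    (m : 'I_n.+1) : R -> R :=
  fun s => 'D_(delta_mx 0 m) L (kappa_jet n x y s).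

Definition euler_op (R : realType) (n : nat) (L : 'rV[R]_n.+1 -> R)
    (x y : R -> R) : R -> R :=
  fun s => \sum_(m < n.+1) (-1) ^+ m * iter m (Ds x y) (dL L x y m) s.

Definition double_sum (R : realType) (n : nat) (L : 'rV[R]_n.+1 -> R)
    (x y : R -> R) : R -> R :=
  fun s => \sum_(m < n.+1 | (1 <= m)%N) \sum_(0 <= j < m)
    (-1) ^+ j * iter j (Ds x y) (dL L x y m) s * kappa x y (m - j) s.

Definition lambda (R : realType) (n : nat) (L : 'rV[R]_n.+1 -> R)
    (x y : R -> R) : R -> R :=
  fun s => - L (kappa_jet n x y s) + double_sum L x y s.

Definition EL (R : realType) (n : nat) (L : 'rV[R]_n.+1 -> R)
    (x y : R -> R) : R -> R :=
  fun s => Ds x y (Ds x y (euler_op L x y)) s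
    + curvature x y s ^+ 2 * euler_op L x y s
    - curvature x y s * (L (kappa_jet n x y s) - double_sum L x y s).

(** * Noether's conservation laws for SE(2) *)

Definition noether_matrix (R : realType) (x y : R -> R) (s : R) : 'M[R]_3 :=
  let xs := Ds x y x s in
  let ys := Ds x y y s in
  \matrix_(i < 3, j < 3) nth 0 (nth [::]
    [:: [:: xs; - ys; 0];
        [:: ys; xs; 0];
        [:: x s * ys - y s * xs; x s * xs + y s * ys; 1]] i) j.

Definition noether_vector (R : realType) (n : nat) (L : 'rV[R]_n.+1 -> R)
    (x y : R -> R) (s : R) : 'cV[R]_3 :=
  let E := euler_op L x y in
  \col_(i < 3) nth 0
    [:: - lambda L x y s - curvature x y s * E s; - Ds x y E s; E s] i.

(* Infinitesimal generators of SE(2): translation along the first axis,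
   translation along the second axis, rotation about the origin. *)
Definition se2_generator (R : realType) (i : 'I_3) (a b : R) : R * R :=
  nth (0, 0) [:: (1, 0); (0, 1); (- b, a)] i.

(* [J] is the Noether current of the infinitesimal symmetry [v] along the curve:
   displacing the curve by [chi v], with [chi] a smooth function supported in
   [[p, q]], has first variation the integral of [chi' J]. This determines a
   continuous [J] up to an additive constant, on every curve and not only on
   the extremal ones; on an extremal curve it says that [J] is constant. *)
Definition noether_current (R : realType) (n : nat) (L : 'rV[R]_n.+1 -> R)
    (I : set R) (x y : R -> R) (v : R -> R -> R * R) (J : R -> R) : Prop :=
  forall (p q : R) (chi : R -> R),
    `[p, q] `<=` I -> smooth_on [set: R] chi ->
    (forall u, ~ `[p, q]%classic u -> chi u = 0) ->
    is_derive (0 : R) (1 : R)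
      (fun e : R => action L p q
         (fun u => x u + e * chi u * (v (x u) (y u)).1)
         (fun u => y u + e * chi u * (v (x u) (y u)).2))
      (\int[lebesgue_measure]_(u in `[p, q]) (derive1 chi u * J u)).

(* Main.v *)
Require Import Defs.
From HB Require Import structures.
From mathcomp Require Import all_boot all_order all_algebra.
From mathcomp Require Import all_classical all_reals all_analysis.
From mathcomp Require Import ring lra.
Import Order.TTheory GRing.Theory Num.Theory.
Import numFieldNormedType.Exports.

Set Implicit Arguments.
Unset Strict Implicit.
Unset Printing Implicit Defensive.

Local Open Scope classical_set_scope.
Local Open Scope ring_scope.

(** Write the variation field of a unit speed curve as [a T + b N], with tangent
    [T] and normal [N]. The derivative in the variation parameter and [d/ds]
    commute up to a multiple of [d/ds], so [kappa_m] varies by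
    [a kappa_(m+1) + g_m] with [g_0 = b'' + kappa^2 b] and
    [g_(m+1) = g_m' + kappa b kappa_(m+1)]. Integrating by parts in
    [sum_m (dL/dkappa_m) g_m] turns the variation of [L ds] into [b EL] plus the
    derivative of a function which, like [a] and [b], vanishes outside the
    support of the variation. The first variation is therefore the integral of
    [b EL], and testing on [b = chi^2 EL] for bump functions [chi] gives the
    Euler-Lagrange equation.

    For the conservation laws, [lambda' = - kappa_1 E(L)] because the double sum
    telescopes under differentiation; hence each component [J] of the matrix
    product has [J' = - b EL], with [b] the normal component of the generator.
    Off extremals, integrating [chi b EL = chi' J - (chi J)'] identifies [J] as
    the Noether current. *)

(** * Directional derivatives and the class C^k *)

Section DirectionalDerivative.
Context {R : realType} {V : normedModType R}.
Implicit Types (f : V -> R) (a v : V).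

(** [smooth_on] speaks of directional derivatives only, so the symmetry of mixed derivatives and the
    chain rule for [L] along the jet are extracted from the mean value theorem and the continuity of
    these derivatives. For nonzero [e] the varied curves lose unit speed and may become singular, so
    their curvatures are smooth only on some open neighbourhood of the slice [e = 0]; compactness of
    the segment turns it into a uniform strip, as differentiation under the integral requires.
    Integration by parts is carried out pointwise, modulo derivatives of functions supported in the
    segment, and integrals are compared only once at the end. The bump enters squared so that the
    tested integrand is itself a square, and the vanishing of its integral gives the equation with
    no discussion of signs. *)

Lemma derive_line f a v : 'D_v f a = 'D_1 (fun h : R => f (h *: v + a)) 0.
Proof.
rewrite /derive.
have -> : (fun h : R => h^-1 *: ((f \o shift a) (h *: v) - f a)) =
    (fun h : R => h^-1 *: (((fun h => f (h *: v + a)) \o shift 0) (h *: (1 : R))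
      - f (0 *: v + a))).
  by apply/funext => h /=; rewrite scale0r add0r addr0 [h%:A]mulr1.
by [].
Qed.

(** Pulls directional derivatives back to one real variable, where the chain rule and the mean value
    theorem apply without total differentiability of [f]. *)
Lemma is_derive_line f a v (df : R) :
  is_derive a v f df <-> is_derive (0 : R) 1 (fun h : R => f (h *: v + a)) df.
Proof.
split=> [] [h1 h2]; split.
- exact: (derivable1P f a v).1.
- by rewrite -derive_line.
- exact: (derivable1P f a v).2.
- by rewrite derive_line.
Qed.

End DirectionalDerivative.

Section DirectionalDerivativeComp.
Context {R : realType} {V : normedModType R}.
Implicit Types (f : V -> R) (a v : V).

Lemma is_derive_line_at f a v (t : R) (df : R) :
  is_derive (t *: v + a) v f df ->
  is_derive t 1 (fun h : R => f (h *: v + a)) df.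
Proof.
move=> /is_derive_line H; apply/is_derive_line.
congr is_derive: H; apply/funext => h.
by rewrite addrA -scalerDl [h%:A]mulr1.
Qed.

Lemma is_derive_comp1 f (g : R -> R) a v (df dg : R) :
  is_derive a v f df -> is_derive (f a) (1 : R) g dg ->
  is_derive a v (g \o f) (dg * df).
Proof.
move=> /is_derive_line Hf Hg; apply/is_derive_line.
have F0 : f (0 *: v + a) = f a by rewrite scale0r add0r.
rewrite -F0 in Hg; exact: is_derive1_comp.
Qed.

End DirectionalDerivativeComp.

(** * Stability of the class C^k *)

Section CkOn.
Context {R : realType} {V : normedModType R}.
Implicit Types (U : set V) (f g : V -> R) (a v : V) (k : nat).

Lemma near_open_eq U f g a : open U -> (forall b, U b -> f b = g b) -> U a ->
  \forall b \near a, f b = g b.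
Proof. by move=> oU fg Ua; apply: filterS fg _; exact: open_nbhs_nbhs. Qed.

Lemma eq_Ck_on U k f g : open U -> (forall a, U a -> f a = g a) ->
  Ck_on U k f -> Ck_on U k g.
Proof.
move=> oU; elim: k f g => [|k IH] f g fg /= [cf H]; split.
- move=> a Ua; rewrite /prop_for /continuous_at -fg//.
  apply: cvg_trans (cf _ Ua); apply: near_eq_cvg.
  exact: near_open_eq Ua.
- by [].
- move=> a Ua; rewrite /prop_for /continuous_at -fg//.
  apply: cvg_trans (cf _ Ua); apply: near_eq_cvg.
  exact: near_open_eq Ua.
- case: H => [df Cf]; split.
    move=> v a Ua; apply: near_eq_derivable (df v a Ua).
    exact: near_open_eq Ua.
  move=> v; apply: IH (Cf v) => a Ua; apply: near_eq_derive.
  exact: near_open_eq Ua.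
Qed.

Lemma sub_Ck_on U U' k f : U' `<=` U -> Ck_on U k f -> Ck_on U' k f.
Proof.
move=> UU'; elim: k f => [|k IH] f /= [cf H]; split=> //.
- by move=> a /UU'; exact: cf.
- by move=> a /UU'; exact: cf.
- case: H => df Cf; split; first by move=> v a /UU'; exact: df.
  by move=> v; apply: IH; exact: Cf.
Qed.

Lemma Ck_onS U k f : Ck_on U k.+1 f -> Ck_on U k f.
Proof.
elim: k f => [|k IH] f; first by case.
move=> [cf [df Cf]]; split=> //; split=> // v.
by apply: IH; exact: Cf.
Qed.

Lemma Ck_on_is_derive U k f v a : Ck_on U k.+1 f -> U a ->
  is_derive a v f ('D_v f a).
Proof. by move=> [_ [df _]] Ua; split=> //; exact: df. Qed.

Lemma Ck_on_continuous U k f a : Ck_on U k f -> U a -> {for a, continuous f}.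
Proof. by case: k => [|k] [cf _]; exact: cf. Qed.

(** The values of ['D_v f] outside [U] are uncontrolled; a formula [df] that is right on [U]
    suffices, and the closure proofs below induct through it. *)
Lemma Ck_on_intro U k f (df : V -> V -> R) : open U ->
  (forall a, U a -> {for a, continuous f}) ->
  (forall v a, U a -> is_derive a v f (df v a)) ->
  (forall v, Ck_on U k (df v)) -> Ck_on U k.+1 f.
Proof.
move=> oU cf Hf Cdf; split=> //; split=> [v a Ua|v]; first by case: (Hf v a Ua).
by apply: eq_Ck_on (Cdf v) => // a Ua; case: (Hf v a Ua).
Qed.

Lemma Ck_on_cst U k (c : R) : open U -> Ck_on U k (fun=> c).
Proof.
move=> oU; elim: k c => [|k IH] c; first by split=> // a _; exact: cst_continuous.
apply: (@Ck_on_intro _ _ _ (fun _ _ => 0)) => //.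
by move=> a _; exact: cst_continuous.
Qed.

Lemma Ck_onD U k f g : open U -> Ck_on U k f -> Ck_on U k g ->
  Ck_on U k (fun a => f a + g a).
Proof.
move=> oU; elim: k f g => [|k IH] f g Hf Hg.
  split=> // a Ua.
  by apply: continuousD; [exact: Ck_on_continuous Hf Ua|exact: Ck_on_continuous Hg Ua].
apply: (@Ck_on_intro _ _ _ (fun v a => 'D_v f a + 'D_v g a)) => //.
- move=> a Ua.
  by apply: continuousD; [exact: Ck_on_continuous Hf Ua|exact: Ck_on_continuous Hg Ua].
- move=> v a Ua; apply: is_deriveD.
    exact: Ck_on_is_derive Hf Ua.
  exact: Ck_on_is_derive Hg Ua.
- move=> v; apply: IH.
    by case: Hf => _ [_]; exact.
  by case: Hg => _ [_]; exact.
Qed.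

Lemma Ck_onM U k f g : open U -> Ck_on U k f -> Ck_on U k g ->
  Ck_on U k (fun a => f a * g a).
Proof.
move=> oU; elim: k f g => [|k IH] f g Hf Hg.
  split=> // a Ua.
  by apply: continuousM; [exact: Ck_on_continuous Hf Ua|exact: Ck_on_continuous Hg Ua].
apply: (@Ck_on_intro _ _ _ (fun v a => f a * 'D_v g a + g a * 'D_v f a)) => //.
- move=> a Ua.
  by apply: continuousM; [exact: Ck_on_continuous Hf Ua|exact: Ck_on_continuous Hg Ua].
- move=> v a Ua; apply: is_deriveM.
    exact: Ck_on_is_derive Hf Ua.
  exact: Ck_on_is_derive Hg Ua.
- move=> v; apply: Ck_onD => //; apply: IH; try exact: Ck_onS.
    by case: Hg => _ [_]; exact.
  by case: Hf => _ [_]; exact.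
Qed.

End CkOn.

Lemma Ck_on_comp (R : realType) (V : normedModType R) (U : set V) (S : set R) k
    (f : V -> R) (g : R -> R) :
  open U -> (forall a, U a -> S (f a)) ->
  Ck_on S k g -> Ck_on U k f -> Ck_on U k (g \o f).
Proof.
move=> oU US; elim: k f g US => [|k IH] f g US Hg Hf.
  split=> // a Ua; apply: continuous_comp; first exact: Ck_on_continuous Hf Ua.
  exact: Ck_on_continuous Hg (US _ Ua).
apply: (@Ck_on_intro _ _ _ _ _ (fun v a => 'D_1 g (f a) * 'D_v f a)) => //.
- move=> a Ua; apply: continuous_comp; first exact: Ck_on_continuous Hf Ua.
  exact: Ck_on_continuous Hg (US _ Ua).
- move=> v a Ua; apply: is_derive_comp1; first exact: Ck_on_is_derive Hf Ua.
  exact: Ck_on_is_derive Hg (US _ Ua).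
- move=> v; apply: Ck_onM => //; last by case: Hf => _ [_]; exact.
  apply: (IH f ('D_1 g)) => //; last exact: Ck_onS.
  by case: Hg => _ [_]; exact.
Qed.

Section SmoothOn.
Context {R : realType} {V : normedModType R}.
Variables (U : set V) (oU : open U).
Implicit Types (f g : V -> R) (a v : V) (k : nat).

Lemma smooth_on_continuous f a : smooth_on U f -> U a -> {for a, continuous f}.
Proof. by move=> /(_ 0%N)/Ck_on_continuous; exact. Qed.

Lemma smooth_on_is_derive f v a : smooth_on U f -> U a ->
  is_derive a v f ('D_v f a).
Proof. by move=> /(_ 1%N)/Ck_on_is_derive; exact. Qed.

Lemma eq_smooth_on f g : (forall a, U a -> f a = g a) ->
  smooth_on U f -> smooth_on U g.
Proof. by move=> fg Hf k; apply: eq_Ck_on (Hf k). Qed.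

Lemma sub_smooth_on U' f : U `<=` U' -> smooth_on U' f -> smooth_on U f.
Proof. by move=> UU' Hf k; apply: sub_Ck_on (Hf k). Qed.

Lemma smooth_on_cst (c : R) : smooth_on U (fun=> c).
Proof. by move=> k; exact: Ck_on_cst. Qed.

Lemma smooth_onD f g : smooth_on U f -> smooth_on U g ->
  smooth_on U (fun a => f a + g a).
Proof. by move=> Hf Hg k; apply: Ck_onD. Qed.

Lemma smooth_onM f g : smooth_on U f -> smooth_on U g ->
  smooth_on U (fun a => f a * g a).
Proof. by move=> Hf Hg k; apply: Ck_onM. Qed.

Lemma smooth_onN f : smooth_on U f -> smooth_on U (fun a => - f a).
Proof.
move=> Hf; apply: (@eq_smooth_on (fun a => -1 * f a)).
  by move=> a _; rewrite mulN1r.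
by apply: smooth_onM => //; exact: smooth_on_cst.
Qed.

Lemma smooth_onB f g : smooth_on U f -> smooth_on U g ->
  smooth_on U (fun a => f a - g a).
Proof. by move=> Hf Hg; apply: smooth_onD => //; exact: smooth_onN. Qed.

Lemma smooth_onX f n : smooth_on U f -> smooth_on U (fun a => f a ^+ n).
Proof.
move=> Hf; elim: n => [|n IH]; first exact: smooth_on_cst.
apply: (@eq_smooth_on (fun a => f a * f a ^+ n)).
  by move=> a _; rewrite exprS.
exact: smooth_onM.
Qed.

Lemma smooth_on_sum (T : Type) (r : seq T) (P : pred T) (F : T -> V -> R) :
  (forall i, P i -> smooth_on U (F i)) ->
  smooth_on U (fun a => \sum_(i <- r | P i) F i a).
Proof.
move=> H; elim: r => [|i r IH].
  by apply: eq_smooth_on (smooth_on_cst 0) => a _; rewrite big_nil.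
have [Pi|nPi] := boolP (P i).
  apply: (@eq_smooth_on (fun a => F i a + \sum_(j <- r | P j) F j a)).
    by move=> a _; rewrite big_cons Pi.
  by apply: smooth_onD => //; exact: H.
by apply: eq_smooth_on IH => a _; rewrite big_cons (negbTE nPi).
Qed.

Lemma smooth_on_derive f v : smooth_on U f -> smooth_on U ('D_v f).
Proof. by move=> Hf k; case: (Hf k.+1) => _ [_]; exact. Qed.

Lemma smooth_on_comp (S : set R) f (g : R -> R) :
  (forall a, U a -> S (f a)) -> smooth_on S g -> smooth_on U f ->
  smooth_on U (fun a => g (f a)).
Proof. by move=> US Hg Hf k; apply: (Ck_on_comp oU US (Hg k) (Hf k)). Qed.

End SmoothOn.

(** * Smoothness of projections, inverse and square root *)

Section SmoothFunctions.
Context {R : realType}.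

Lemma smooth_on_id (U : set R) : open U -> smooth_on U id.
Proof.
move=> oU [|k]; first by split=> // a _; exact: cvg_id.
apply: (@Ck_on_intro _ _ _ _ _ (fun v _ => v)) => //.
- by move=> a _; exact: cvg_id.
- by move=> v; exact: Ck_on_cst.
Qed.

Lemma is_derive_scale_line (v a : R) :
  is_derive (0 : R) 1 (fun h : R => h *: v + a) v.
Proof.
have -> : (fun h : R => h *: v + a) = (fun h => v * h + a).
  by apply/funext => h; rewrite /GRing.scale/= mulrC.
have := @is_deriveD R R R (fun h => v * h) (cst a) 0 1 v 0.
rewrite addr0; apply.
have := @is_deriveZ R R R id v 0 1 1 _.
by rewrite /GRing.scale /= mulr1; apply; exact: is_derive_id.
Qed.

Lemma is_derive_fst (a v : R * R) : is_derive a v (fst : R * R -> R) v.1.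
Proof.
apply/is_derive_line.
exact: is_derive_scale_line.
Qed.

Lemma is_derive_snd (a v : R * R) : is_derive a v (snd : R * R -> R) v.2.
Proof.
apply/is_derive_line.
exact: is_derive_scale_line.
Qed.

Lemma smooth_on_fst (U : set (R * R)) : open U -> smooth_on U (fst : R * R -> R).
Proof.
move=> oU; have c a : {for a, continuous (fst : R * R -> R)} by exact: cvg_fst.
case=> [|k]; first by split=> [a _|]; [exact: c|exact: I].
apply: (@Ck_on_intro R (R * R)%type U k (fst : R * R -> R) (fun v _ => v.1) oU).
- by move=> a _; exact: c.
- by move=> v a _; exact: is_derive_fst.
- by move=> v; exact: Ck_on_cst.
Qed.

Lemma smooth_on_snd (U : set (R * R)) : open U -> smooth_on U (snd : R * R -> R).
Proof.
move=> oU; have c a : {for a, continuous (snd : R * R -> R)} by exact: cvg_snd.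
case=> [|k]; first by split=> [a _|]; [exact: c|exact: I].
apply: (@Ck_on_intro R (R * R)%type U k (snd : R * R -> R) (fun v _ => v.2) oU).
- by move=> a _; exact: c.
- by move=> v a _; exact: is_derive_snd.
- by move=> v; exact: Ck_on_cst.
Qed.

Lemma open_neq0 : open [set t : R | t != 0].
Proof.
rewrite (_ : mkset _ = ~` [set 0]); last by apply/seteqP; split => t /= /eqP.
exact/closed_openC/closed_eq.
Qed.

(** The derivative is a polynomial in the inverse itself, so the induction on the order closes
    up. *)
Lemma smooth_on_inv : smooth_on [set t : R | t != 0] (@GRing.inv R).
Proof.
elim=> [|k IH]; first by split=> // a; exact: inv_continuous.
apply: (@Ck_on_intro R R [set t : R | t != 0] k (@GRing.inv R)
  (fun v t : R => - v * (t^-1 * t^-1))).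
- exact: open_neq0.
- exact: inv_continuous.
- move=> v a a0; apply: is_derive_eq (is_deriveV _ (is_derive_id a v)) _ => //.
  by rewrite /GRing.scale/= expr2 invfM mulNr mulrC mulNr.
- move=> v; apply: Ck_onM; [exact: open_neq0|apply: Ck_on_cst; exact: open_neq0|].
  by apply: Ck_onM => //; exact: open_neq0.
Qed.

Lemma smooth_on_sqrt : smooth_on [set t : R | 0 < t] (@Num.sqrt R).
Proof.
have o : open [set t : R | 0 < t] by exact: open_gt.
elim=> [|k IH]; first by split=> // a _; exact: sqrt_continuous.
apply: (@Ck_on_intro R R [set t : R | 0 < t] k (@Num.sqrt R)
  (fun v t : R => v * 2^-1 * (Num.sqrt t)^-1) o).
- by move=> a _; exact: sqrt_continuous.
- move=> v a a0; apply/is_derive_line.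
  have := @is_derive1_comp R (@Num.sqrt R) (fun h : R => h *: v + a) 0
    (2 * Num.sqrt (0 *: v + a))^-1 v.
  rewrite scale0r add0r => /(_ (is_derive1_sqrt a0)) H.
  have {}H := H (@is_derive_scale_line v a).
  by apply: is_derive_eq H _; rewrite mulrC invfM mulrA.
- move=> v; apply: Ck_onM; [exact: o|exact: Ck_on_cst|].
  apply: (@Ck_on_comp R R _ [set t : R | t != 0] k (@Num.sqrt R) _ o) => //.
    by move=> a /= a0; rewrite gt_eqF// sqrtr_gt0.
  exact: smooth_on_inv.
Qed.

End SmoothFunctions.

(** * Symmetry of mixed derivatives and the chain rule *)

Section Schwarz.
Context {R : realType} {V : normedModType R}.
Implicit Types (f : V -> R) (a v w : V).

Lemma mean_value_dir f v a (h : R) : 0 <= h ->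
  (forall s, 0 <= s <= h -> derivable f (s *: v + a) v) ->
  exists2 s, 0 <= s <= h & f (h *: v + a) - f a = 'D_v f (s *: v + a) * h.
Proof.
move=> h0 df.
have Hd s : 0 <= s <= h ->
    is_derive s 1 (fun s : R => f (s *: v + a)) ('D_v f (s *: v + a)).
  by move=> sh; apply: is_derive_line_at; split=> //; exact: df.
have [||s] := @MVT_segment R (fun s : R => f (s *: v + a))
   (fun s => 'D_v f (s *: v + a)) 0 h h0.
- move=> s; rewrite in_itv/= => /andP[s0 sh]; apply: Hd; lra.
- apply: derivable_within_continuous => s; rewrite in_itv/= => s0h.
  by case: (Hd _ s0h).
- rewrite in_itv/= scale0r add0r subr0 => s0h E; exists s => //.
Qed.

(** The second difference is an increment in direction [v] of an increment in direction [w], so two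
    mean value steps apply. It is symmetric in [v] and [w], although the mixed derivative it is
    equated with is not visibly so. *)
Lemma second_difference f v w a (h : R) : 0 <= h ->
  (forall s t, 0 <= s <= h -> 0 <= t <= h ->
    derivable f (s *: v + (t *: w + a)) v /\
    derivable ('D_v f) (s *: v + (t *: w + a)) w) ->
  exists s t, [/\ 0 <= s <= h, 0 <= t <= h &
    f (h *: v + (h *: w + a)) - f (h *: v + a) - f (h *: w + a) + f a =
    'D_w ('D_v f) (s *: v + (t *: w + a)) * h ^+ 2].
Proof.
move=> h0 df.
pose F b := f (h *: w + b) - f b.
have DF s : 0 <= s <= h -> is_derive (s *: v + a) v F
    ('D_v f (s *: v + (h *: w + a)) - 'D_v f (s *: v + a)).
  move=> sh; apply: is_deriveB.
    apply/is_derive_line.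
    have -> : (fun t : R => f (h *: w + (t *: v + (s *: v + a)))) =
       (fun t : R => f (t *: v + (s *: v + (h *: w + a)))).
      by apply/funext => t; congr f; rewrite !addrA -!(addrC (h *: w)) !addrA.
    apply: (is_derive_line _ _ _ _).1; split=> //.
    have hh : 0 <= h <= h by rewrite h0 lexx.
    exact: (df s h sh hh).1.
  split=> //.
  have h00 : 0 <= (0 : R) <= h by rewrite h0 lexx.
  by have := (df s 0 sh h00).1; rewrite scale0r add0r.
have [|s sh E] := @mean_value_dir F v a h h0.
  by move=> s sh; case: (DF s sh).
have [|t th E2] := @mean_value_dir ('D_v f) w (s *: v + a) h h0.
  move=> t th; case: (df s t sh th) => _.
  by rewrite addrCA.
exists s, t; split=> //.
move: E; case: (DF s sh) => _ -> E.
have -> : s *: v + (t *: w + a) = t *: w + (s *: v + a) by rewrite addrCA.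
rewrite expr2 mulrA -E2.
have -> : f (h *: v + (h *: w + a)) - f (h *: v + a) - f (h *: w + a) + f a
  = F (h *: v + a) - F a.
  by rewrite /F addrCA; ring.
by rewrite E addrCA.
Qed.

Lemma near_plane v w a (P : set V) : nbhs a P ->
  exists2 h : R, 0 < h & forall s t, 0 <= s <= h -> 0 <= t <= h ->
    P (s *: v + (t *: w + a)).
Proof.
move=> Pa.
have /(_ _ Pa) : (p.1 *: v + (p.2 *: w + a)) @[p --> (0 : R, 0 : R)] --> a.
  rewrite -[X in _ --> X]add0r -(scale0r v) -[X in _ --> _ + X]add0r.
  rewrite -[X in _ --> _ + (X + _)](scale0r w).
  by apply: cvgD; [apply: cvgZr_tmp; exact: cvg_fst|apply: cvgD;
    [apply: cvgZr_tmp; exact: cvg_snd|exact: cvg_cst]].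
move=> /nbhs_ballP[e /= e0 H].
exists (e / 2); first by rewrite divr_gt0.
move=> s t /andP[s0 se] /andP[t0 te]; apply: (H (s, t)).
by split; rewrite /ball/= sub0r normrN ger0_norm//; lra.
Qed.

(** Each mixed derivative, at its own point of a small parallelogram, equals the same second
    difference divided by [h ^+ 2]; continuity at [a] makes the two values at [a] agree. *)
Lemma derive_swap (U : set V) f v w a : open U -> smooth_on U f -> U a ->
  'D_w ('D_v f) a = 'D_v ('D_w f) a.
Proof.
move=> oU Hf Ua.
apply/eqP; rewrite -subr_eq0 -normr_le0; apply/ler_addgt0Pr => e e0.
rewrite add0r.
have e20 : 0 < e / 2 by rewrite divr_gt0.
have tri (x y z : R) : `|x - z| < e / 2 -> `|y - z| < e / 2 -> `|x - y| <= e.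
  move=> xz yz; rewrite (_ : x - y = (x - z) - (y - z)); last by ring.
  by rewrite (le_trans (ler_normB _ _))// (splitr e) lerD// ltW.
have cont u1 u2 : \forall b \near a, `|'D_u1 ('D_u2 f) a - 'D_u1 ('D_u2 f) b| < e / 2.
  have : {for a, continuous ('D_u1 ('D_u2 f))}.
    by apply: smooth_on_continuous Ua; do 2 apply: smooth_on_derive.
  by move=> /cvgrPdist_lt/(_ _ e20).
have [h h0 H] := @near_plane v w a _
  (filterI (open_nbhs_nbhs (conj oU Ua)) (filterI (cont w v) (cont v w))).
have D u s t : 0 <= s <= h -> 0 <= t <= h ->
    derivable f (s *: v + (t *: w + a)) u.
  move=> sh th; have [Up _] := H s t sh th.
  by have [] := smooth_on_is_derive u Hf Up.
have D2 u1 u2 s t : 0 <= s <= h -> 0 <= t <= h ->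
    derivable ('D_u1 f) (s *: v + (t *: w + a)) u2.
  move=> sh th; have [Up _] := H s t sh th.
  by have [] := smooth_on_is_derive u2 (smooth_on_derive u1 Hf) Up.
have [|s1 [t1 [s1h t1h E1]]] := @second_difference f v w a h (ltW h0).
  by move=> s t sh th; split; [exact: D|exact: D2].
have [|t2 [s2 [t2h s2h E2]]] := @second_difference f w v a h (ltW h0).
  by move=> t s th sh; rewrite addrCA; split; [exact: D|exact: D2].
have [_ [+ _]] := H _ _ s1h t1h; have [_ [_ +]] := H _ _ s2h t2h.
rewrite addrCA.
have : 'D_w ('D_v f) (s1 *: v + (t1 *: w + a)) =
       'D_v ('D_w f) (t2 *: w + (s2 *: v + a)).
  apply: (@mulIf _ (h ^+ 2)); first by rewrite expf_neq0// gt_eqF.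
  apply: etrans (esym E1) _; apply: etrans E2.
  by rewrite (addrCA (h *: w)) (addrAC _ (- f (h *: v + a))).
by move=> -> Bw Av; exact: tri Av Bw.
Qed.

End Schwarz.

Lemma is_derive0P (R : realType) (f : R -> R) (df : R) :
  is_derive (0 : R) 1 f df <-> h^-1 * (f h - f 0) @[h --> 0^'] --> df.
Proof.
have E : (fun h : R => h^-1 *: ((f \o shift 0) (h *: (1 : R)) - f 0)) =
         (fun h => h^-1 * (f h - f 0)).
  by apply/funext => h /=; rewrite addr0 [h%:A]mulr1.
split=> [[]|H]; first by rewrite /derivable /derive E => + <-.
split; first by rewrite /derivable E; apply/cvg_ex; exists df.
by rewrite /derive E; apply/cvg_lim.
Qed.

(** * Chain rule from continuous partial derivatives *)

Section ChainRule.
Context {R : realType} {n : nat}.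
Implicit Types (L : 'rV[R]_n -> R) (z w : 'rV[R]_n).

(* Changing one coordinate at a time telescopes the increments of [L]. *)
Definition hybrid z w (k : nat) : 'rV[R]_n :=
  \row_i (if (i < k)%N then w 0 i else z 0 i).

Lemma hybridS z w (k : 'I_n) :
  hybrid z w k.+1 = (w 0 k - z 0 k) *: delta_mx 0 k + hybrid z w k.
Proof.
apply/rowP => i; rewrite !mxE ltnS leq_eqVlt /=.
have [->|ik] := eqVneq i k; first by rewrite eqxx ltnn /= mulr1 subrK.
by rewrite (inj_eq val_inj) (negbTE ik) /= mulr0 add0r.
Qed.

(** Keeping the intermediate point in the coordinate box spanned by [z] and [w] makes it converge to
    [z] when [w] does. *)
Lemma mean_value_coord L z w (k : 'I_n) :
  (forall y i, derivable L y (delta_mx 0 i)) ->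
  exists2 y : 'rV[R]_n, (forall i, `|y 0 i - z 0 i| <= `|w 0 i - z 0 i|) &
    L (hybrid z w k.+1) - L (hybrid z w k) =
      'D_(delta_mx 0 k) L y * (w 0 k - z 0 k).
Proof.
move=> dL.
have aux (s : R) : (`|s| <= `|w 0 k - z 0 k|) ->
    forall i, `|(s *: delta_mx 0 k + hybrid z w k) 0 i - z 0 i| <=
              `|w 0 i - z 0 i|.
  move=> sk i; rewrite !mxE /=; have [->|ik] := eqVneq i k.
    by rewrite ltnn mulr1 addrK.
  by rewrite mulr0 add0r; case: ifP => // _; rewrite subrr normr0.
have [d0|d0] := leP 0 (w 0 k - z 0 k).
  have [s ? E|s /andP[s0 sd] E] :=
    @mean_value_dir R _ L (delta_mx 0 k) (hybrid z w k) _ d0; first exact: dL.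
  exists (s *: delta_mx 0 k + hybrid z w k).
    by apply: aux; rewrite !ger0_norm.
  by rewrite hybridS E.
(* For a negative increment the mean value theorem starts from the far end [hybrid z w k.+1] and
   moves by the positive amount [z 0 k - w 0 k]. *)
have d1 : 0 <= - (w 0 k - z 0 k) by rewrite oppr_ge0 ltW.
have [s ? E|s /andP[s0 sd] E] :=
  @mean_value_dir R _ L (delta_mx 0 k) (hybrid z w k.+1) _ d1; first exact: dL.
exists (s *: delta_mx 0 k + hybrid z w k.+1).
  rewrite hybridS addrA -scalerDl; apply: aux.
  by rewrite !ler0_norm//; [lra|exact: ltW|lra].
rewrite mulrN in E; rewrite -[RHS]opprK -E hybridS addrA -scalerDl addNr.
by rewrite scale0r add0r opprB.
Qed.

(** Each telescoped increment is a partial derivative at a chosen point times an increment of one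
    coordinate; its difference quotient converges because the chosen points tend to [g 0]. *)
Lemma is_derive_chain_line L (g : R -> 'rV[R]_n) (dg : 'I_n -> R) :
  (forall y i, derivable L y (delta_mx 0 i)) ->
  (forall i, {for g 0, continuous ('D_(delta_mx 0 i) L)}) ->
  (forall i, is_derive (0 : R) 1 (fun h => g h 0 i) (dg i)) ->
  is_derive (0 : R) 1 (fun h => L (g h))
    (\sum_i 'D_(delta_mx 0 i) L (g 0) * dg i).
Proof.
move=> dL cL Hg.
have h0 k : hybrid (g 0) (g 0) k = g 0.
  by apply/rowP => i; rewrite mxE; case: ifP.
have cg i : (fun h => g h 0 i) @ (0 : R)^' --> g 0 0 i.
  have : {for 0 : R, continuous (fun h => g h 0 i)}.
    by apply: differentiable_continuous; apply/derivable1_diffP; case: (Hg i).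
  exact: cvg_within_filter.
have step (k : 'I_n) : is_derive (0 : R) 1
    (fun h => L (hybrid (g 0) (g h) k.+1) - L (hybrid (g 0) (g h) k))
    ('D_(delta_mx 0 k) L (g 0) * dg k).
  have /choice[y Hy] : forall h : R, exists y : 'rV[R]_n,
      (forall i, `|y 0 i - g 0 0 i| <= `|g h 0 i - g 0 0 i|) /\
      L (hybrid (g 0) (g h) k.+1) - L (hybrid (g 0) (g h) k) =
      'D_(delta_mx 0 k) L y * (g h 0 k - g 0 0 k).
    by move=> h; have [y ? ?] := mean_value_coord (g 0) (g h) k dL; exists y.
  have cy : y @ (0 : R)^' --> g 0.
    apply/cvgrPdist_le => e e0; near=> x.
    rewrite /Num.Def.normr/= mx_normrE (bigmax_le _ (ltW e0))//= => -[i j] _ /=.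
    rewrite !mxE/= (ord1 i) distrC (le_trans ((Hy x).1 j))//.
    move: j; near: x; apply: filter_forall => /= j.
    have /cvgrPdist_le/(_ e e0) := cg j.
    by apply: filterS => x; rewrite distrC.
  apply/is_derive0P; rewrite !h0 subrr.
  under eq_fun => h do rewrite subr0 (Hy h).2 mulrCA.
  apply: cvgM; first exact: cvg_comp cy (cL k).
  by apply/is_derive0P.
have -> : (fun h => L (g h)) = cst (L (g 0)) + \sum_(k < n)
    (fun h => L (hybrid (g 0) (g h) k.+1) - L (hybrid (g 0) (g h) k)).
  apply/funext => h; rewrite fctE fct_sumE.
  rewrite -(big_mkord predT (fun k => L (hybrid (g 0) (g h) k.+1) -
    L (hybrid (g 0) (g h) k))) telescope_sumr//.
  have -> : hybrid (g 0) (g h) n = g h by apply/rowP => i; rewrite mxE ltn_ord.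
  have -> : hybrid (g 0) (g h) 0 = g 0 by apply/rowP => i; rewrite mxE.
  by rewrite addrC subrK.
rewrite -[X in is_derive _ _ _ X]add0r; apply: is_deriveD.
Unshelve. all: by end_near. Qed.

End ChainRule.

Section SmoothChain.
Context {R : realType} {V : normedModType R} {n : nat}.
Implicit Types (L : 'rV[R]_n -> R) (J : V -> 'rV[R]_n).

Lemma is_derive_chain L J a v (dJ : 'I_n -> R) :
  smooth_on setT L ->
  (forall i, is_derive a v (fun b => J b 0 i) (dJ i)) ->
  is_derive a v (fun b => L (J b)) (\sum_i 'D_(delta_mx 0 i) L (J a) * dJ i).
Proof.
move=> sL HJ; apply: (is_derive_line (fun b => L (J b)) a v _).2.
have J0 : J (0 *: v + a) = J a by rewrite scale0r add0r.
rewrite -J0; apply: (@is_derive_chain_line R n L (fun h : R => J (h *: v + a)) dJ).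
- by move=> y i; case: (smooth_on_is_derive (delta_mx 0 i) sL (a := y)).
- move=> i; apply: (@smooth_on_continuous R _ setT).
    exact: smooth_on_derive.
  exact: I.
- by move=> i; exact: (is_derive_line (fun b => J b 0 i) a v _).1.
Qed.

Lemma continuous_row J a : (forall i, {for a, continuous (fun b => J b 0 i)}) ->
  {for a, continuous J}.
Proof.
move=> cJ; apply/cvgrPdist_le => e e0; near=> x.
rewrite /Num.Def.normr/= mx_normrE (bigmax_le _ (ltW e0))//= => -[i j] _ /=.
rewrite !mxE/= (ord1 i); move: j; near: x; apply: filter_forall => /= j.
by have /cvgrPdist_le/(_ e e0) := cJ j.
Unshelve. all: by end_near. Qed.

(** The induction runs over all smooth [L] at once, because the derivative formula replaces [L] by
    its partial derivatives. *)
Lemma smooth_on_chain (U : set V) L J : open U -> smooth_on setT L ->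
  (forall i, smooth_on U (fun b => J b 0 i)) -> smooth_on U (fun b => L (J b)).
Proof.
move=> oU + HJ k; elim: k L => [|k IH] L sL.
  split=> // a Ua; apply: continuous_comp.
    by apply: continuous_row => i; exact: smooth_on_continuous (HJ i) Ua.
  exact: (@smooth_on_continuous R _ setT).
apply: (@Ck_on_intro _ _ U k (fun b => L (J b)) (fun v b =>
  \sum_i 'D_(delta_mx 0 i) L (J b) * 'D_v (fun b => J b 0 i) b) oU).
- move=> a Ua; apply: continuous_comp.
    by apply: continuous_row => i; exact: smooth_on_continuous (HJ i) Ua.
  exact: (@smooth_on_continuous R _ setT).
- move=> v a Ua; apply: is_derive_chain => // i.
  exact: smooth_on_is_derive (HJ i) Ua.
- move=> v; elim: (index_enum _) => [|i r IHr].
    apply: (eq_Ck_on oU _ (Ck_on_cst k 0 oU)).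
    by move=> a _; rewrite big_nil.
  apply: (eq_Ck_on (f := fun a => 'D_(delta_mx 0 i) L (J a) *
     'D_v (fun b => J b 0 i) a + \sum_(j <- r) 'D_(delta_mx 0 j) L (J a) *
     'D_v (fun b => J b 0 j) a) oU).
    by move=> a _; rewrite big_cons.
  apply: Ck_onD => //; apply: Ck_onM => //; last exact: smooth_on_derive.
  by apply: (IH ('D_(delta_mx 0 i) L)); exact: smooth_on_derive.
Qed.

End SmoothChain.

(** * Integrals over segments *)

Section IntegralOnSegment.
Context {R : realType}.
Variables (I : set R) (oI : open I).
Implicit Types (f g h : R -> R) (p q : R).
Local Notation mu := (@lebesgue_measure R).

Lemma continuous_on_segment f p q : (forall u, I u -> {for u, continuous f}) ->
  `[p, q] `<=` I -> {within `[p, q], continuous f}.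
Proof.
move=> cf pqI; apply: (@continuous_in_subspaceT _ _ `[p, q]%classic f) => u.
by move=> /set_mem/pqI; exact: cf.
Qed.

Lemma integrable_on_segment f p q : (forall u, I u -> {for u, continuous f}) ->
  `[p, q] `<=` I -> mu.-integrable `[p, q] (EFin \o f).
Proof.
move=> cf pqI; apply: continuous_compact_integrable; first exact: segment_compact.
exact: continuous_on_segment pqI.
Qed.

Lemma Rintegral_derive1 h p q : smooth_on I h -> `[p, q] `<=` I -> p < q ->
  \int[mu]_(u in `[p, q]) derive1 h u = h q - h p.
Proof.
move=> sh pqI pq.
have Ip : I p by apply: pqI; rewrite /= in_itv/= lexx ltW.
have Iq : I q by apply: pqI; rewrite /= in_itv/= lexx ltW.
have E : derive1 h = 'D_1 h by apply/funext => u; rewrite derive1E.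
rewrite /Rintegral (@continuous_FTC2 _ (derive1 h) h)//.
- apply: continuous_on_segment pqI => u Iu; rewrite E.
  by apply: smooth_on_continuous Iu; exact: smooth_on_derive.
- split.
  + move=> u upq; have Iu : I u by apply: pqI; exact: subset_itv_oo_cc.
    by case: (smooth_on_is_derive (1 : R) sh Iu).
  + by apply: cvg_at_right_filter; exact: smooth_on_continuous sh Ip.
  + by apply: cvg_at_left_filter; exact: smooth_on_continuous sh Iq.
Qed.

Lemma Rintegral_congr_exact f g h p q : smooth_on I g -> smooth_on I h ->
  `[p, q] `<=` I -> p < q -> h p = 0 -> h q = 0 ->
  (forall u, I u -> f u = g u + derive1 h u) ->
  \int[mu]_(u in `[p, q]) f u = \int[mu]_(u in `[p, q]) g u.
Proof.
move=> sg sh pqI pq hp hq fgh.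
have E : derive1 h = 'D_1 h by apply/funext => u; rewrite derive1E.
rewrite (_ : \int[mu]_(u in `[p, q]) f u =
  \int[mu]_(u in `[p, q]) (g u + derive1 h u)); last first.
  by apply: eq_Rintegral => u /set_mem/pqI; exact: fgh.
rewrite RintegralD//; last 2 first.
- by apply: integrable_on_segment pqI => u; exact: smooth_on_continuous.
- rewrite E; apply: integrable_on_segment pqI => u.
  by apply: smooth_on_continuous; exact: smooth_on_derive.
by rewrite (Rintegral_derive1 sh pqI pq) hp hq subrr addr0.
Qed.

Lemma Rintegral_eq0_continuous f p q : (forall u, I u -> {for u, continuous f}) ->
  `[p, q] `<=` I -> (forall u, I u -> 0 <= f u) ->
  \int[mu]_(u in `[p, q]) f u = 0 -> forall u, p < u < q -> f u = 0.
Proof.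
move=> cf pqI f0 if0 u /andP[pu uq].
have Iu : I u by apply: pqI; rewrite /= in_itv/= !ltW.
apply/eqP; rewrite eq_le f0// andbT leNgt; apply/negP => fu.
have f2 : f u / 2 < f u by lra.
have upq : u \in `]p, q[ by rewrite in_itv/= pu uq.
have : nbhs u (fun t => (t \in `]p, q[) /\ f u / 2 < f t).
  by apply: filterI; [exact: near_in_itvoo upq|exact: (cvgr_gt _ (cf _ Iu) _ f2)].
move=> /nbhs_ballP[e /= e0 H].
have Hab t : t \in `[u - e / 2, u + e / 2] -> p < t < q /\ f u / 2 < f t.
  rewrite in_itv/= => /andP[t1 t2]; have := H t; rewrite in_itv/=; apply.
  by rewrite /ball/= ltr_norml; apply/andP; split; lra.
have abpq : `[u - e / 2, u + e / 2] `<=` `[p, q].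
  by move=> t /Hab[/andP[? ?] _]; rewrite /= in_itv/= !ltW.
have int_f := integrable_on_segment cf pqI.
have : (0 < \int[mu]_(t in `[p, q]) (f t)%:E)%E.
  apply: (@lt_le_trans _ _ (\int[mu]_(t in `[(u - e / 2)%R, (u + e / 2)%R]) (f u / 2)%:E)%E).
    rewrite integral_cst//= lebesgue_measure_itv/= lte_fin.
    rewrite ifT; last by lra.
    by rewrite -EFinB -EFinM lte_fin mulr_gt0//; lra.
  apply: (@le_trans _ _ (\int[mu]_(t in `[(u - e / 2)%R, (u + e / 2)%R]) (f t)%:E)%E).
    apply: ge0_le_integral => //=.
    - by move=> t _; rewrite lee_fin; lra.
    - apply: (@measurable_funS _ _ _ _ `[p, q]%classic) => //.
      by case/integrableP : int_f.
    - by move=> t /Hab[_ ?]; rewrite lee_fin ltW.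
  apply: ge0_subset_integral => //=.
  - by case/integrableP : int_f.
  - by move=> t /pqI/f0; rewrite lee_fin.
move: if0; rewrite /Rintegral => if0.
by rewrite -(fineK (integrable_fin_num _ int_f))// if0 ltxx.
Qed.

(** Variations are also quantified over degenerate and empty segments; the fundamental theorem is
    applied for [p < q], and this covers the other case. *)
Lemma Rintegral_itv_ge f p q : q <= p ->
  \int[mu]_(u in `[p, q]) f u = 0.
Proof.
rewrite le_eqVlt => /orP[/eqP ->|qp]; first by rewrite set_itv1 Rintegral_set1.
by rewrite set_itv_ge ?Rintegral_set0// bnd_simp -ltNge.
Qed.

End IntegralOnSegment.

(** * Differentiation under the integral sign *)

Section DeriveUnderIntegral.
Context {R : realType}.
Local Notation mu := (@lebesgue_measure R).

(** Compactness makes both the width [r] of the strip and the bound [M] uniform in [u]. *)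
Lemma segment_tube (W : set (R * R)) (F : R * R -> R) (p q : R) :
  open W -> (forall a, W a -> {for a, continuous F}) ->
  (forall u, `[p, q]%classic u -> W (u, 0)) ->
  exists r M : R, [/\ 0 < r, 0 <= M & forall u e, `[p, q]%classic u -> `|e| < r ->
    W (u, e) /\ `|F (u, e)| <= M].
Proof.
move=> oW cF pqW.
have := @segment_compact R p q; move=> /compact_near_coveringP cov.
(* Letting [e] tend to 0 and [M] to infinity along one product filter yields the radius and the
   bound from a single use of compactness. *)
have := cov _ (filter_prod (nbhs (0 : R)) (+oo : set_system R))
  (fun eM u => W (u, eM.1) /\ `|F (u, eM.1)| <= eM.2) _.
move=> /(_ _)[].
  move=> u /pqW Wu.
  have /nbhs_ballP : nbhs (u, 0 : R) [set a | W a /\ `|F a| <= `|F (u, 0)| + 1].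
    apply: filterI; first exact: open_nbhs_nbhs.
    have /cvgrPdist_le/(_ 1 ltr01) := cF _ Wu.
    apply: filterS => b Hb; have := ler_normB (F (u, 0)) (F (u, 0) - F b).
    by rewrite opprB addrC subrK; lra.
  move=> [r /= r0 H].
  exists (ball u r, [set eM : R * R | ball 0 r eM.1 /\ `|F (u, 0)| + 1 <= eM.2]) => /=.
    split; first exact: nbhsx_ballx.
    exists (ball (0 : R) r, [set M | `|F (u, 0)| + 1 <= M]); last by move=> [? ?] /= [].
    split => /=; first exact: nbhsx_ballx.
    by apply: nbhs_pinfty_ge; rewrite num_real.
  move=> [v [e M]] /= [bv [be FM]]; have [Wve Fve] := H (v, e) (conj bv be).
  split; [exact: Wve|exact: le_trans Fve FM].
move=> [A B] /= [/nbhs_ballP[r /= r0 Hr] [M0 [_ HM]]] AB.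
(* The maximum with 0 makes the bound nonnegative, and adding 1 puts it strictly beyond the
   threshold [M0]. *)
have BM : B (Num.max M0 0 + 1) by apply: HM; rewrite ltr_pwDr// le_max lexx.
exists r, (Num.max M0 0 + 1); split=> //.
  by rewrite addr_ge0 ?ler01 ?le_max ?lexx ?orbT.
move=> u e upq er; apply: (AB (e, Num.max M0 0 + 1)) => //=; split=> //.
by apply: Hr; rewrite /ball/= sub0r normrN.
Qed.

Lemma scale_snd_add (u e : R) : e *: ((0, 1) : R * R) + (u, 0) = (u, e).
Proof.
apply: injective_projections.
  exact: etrans (congr1 (+%R^~ u) (mulr0 e)) (add0r u).
exact: etrans (addr0 _) (mulr1 e).
Qed.

Lemma is_derive_slice (F : R * R -> R) (W : set (R * R)) u e : smooth_on W F ->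
  W (u, e) -> is_derive e 1 (fun e => F (u, e)) ('D_((0, 1) : R * R) F (u, e)).
Proof.
move=> sF Wue.
have -> : (fun e => F (u, e)) =
    (fun e : R => F (e *: ((0, 1) : R * R) + (u, 0))).
  by apply/funext => h; rewrite scale_snd_add.
apply: is_derive_line_at; rewrite scale_snd_add.
exact: smooth_on_is_derive sF Wue.
Qed.

(** On the strip given by [segment_tube] the constant [M] dominates the derivative in [e], and it is
    integrable over the compact segment. *)
Lemma is_derive_under_Rintegral (W : set (R * R)) (F : R * R -> R) (p q : R) :
  open W -> smooth_on W F ->
  (forall u, `[p, q]%classic u -> W (u, 0)) ->
  is_derive (0 : R) 1 (fun e => \int[mu]_(u in `[p, q]) F (u, e))
    (\int[mu]_(u in `[p, q]) 'D_((0, 1) : R * R) F (u, 0)).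
Proof.
move=> oW sF pqW.
have [r [M [r0 M0 H]]] := @segment_tube W ('D_((0, 1) : R * R) F) p q oW
  (fun a => smooth_on_continuous (smooth_on_derive _ sF)) pqW.
have Hd e u : `]- r, r[%classic e -> `[p, q]%classic u ->
    is_derive e 1 (fun e => F (u, e)) ('D_((0, 1) : R * R) F (u, e)).
  rewrite /= in_itv/= -ltr_norml => er upq; apply: is_derive_slice sF _.
  by case: (H u e upq er).
have -> : \int[mu]_(u in `[p, q]) 'D_((0, 1) : R * R) F (u, 0) =
  \int[mu]_(u in `[p, q]) partial1of2 (fun e u => F (u, e)) 0 u.
  apply: eq_Rintegral => u /set_mem upq; rewrite partial1of2E.
  by case: (Hd 0 u _ upq) => //; rewrite /= in_itv/= oppr_lt0 r0.
apply/is_derive0P.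
set phi := fun e => \int[mu]_(u in `[p, q]) F (u, e).
have -> : (fun h => h^-1 * (phi h - phi 0)) =
    (fun h => h^-1 *: (phi (h + 0) - phi 0)).
  by apply/funext => h; rewrite addr0.
apply: (@cvg_differentiation_under_integral R _ _ mu (fun e u => F (u, e))
  `[p, q] _ 0 (- r) r _ _ _ (cst M)) => //.
- by rewrite /= in_itv/= oppr_lt0 r0.
- move=> e er; apply: continuous_compact_integrable; first exact: segment_compact.
  apply: (@continuous_in_subspaceT _ _ `[p, q]%classic (fun u => F (u, e))) => u /set_mem upq.
  apply: (@continuous_comp _ _ _ (fun u : R => (u, e)) F).
    move=> A [[B C] [/= Bu Ce] BCA]; apply: filterS Bu => v Bv.
    by apply: BCA; split=> //; exact: nbhs_singleton Ce.
  apply: (smooth_on_continuous sF); move: er; rewrite /= in_itv/= -ltr_norml => er.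
  by case: (H u e upq er).
- by move=> e u er upq; case: (Hd e u er upq).
- apply: continuous_compact_integrable; first exact: segment_compact.
  by apply: continuous_subspaceT; exact: cst_continuous.
- move=> e u er upq; rewrite partial1of2E; case: (Hd e u er upq) => _ ->.
  by move: er; rewrite /= in_itv/= -ltr_norml => er; case: (H u e upq er).
Qed.

End DeriveUnderIntegral.

(** * Smooth bump functions *)

Section Bump.
Context {R : realType}.
Implicit Types (t u p q : R) (j : nat).

Lemma is_derive_dir (f : R -> R) t v (d : R) :
  is_derive t 1 f d -> is_derive t v f (d * v).
Proof.
move=> Hf; have := @is_derive_comp1 R R id f t v v d (is_derive_id t v) Hf.
by [].
Qed.

(* The family t^-j exp(-1/t), extended by zero, is closed under
   differentiation up to linear combinations. *)
Definition flat_exp j t : R := if 0 < t then t^-1 ^+ j * expR (- t^-1) else 0.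

(** With s = 1/t this is the bound of s^(j+1) / (j+1)! by e^s, from the exponential series. It
    governs the behaviour at 0. *)
Lemma flat_exp_le j t : `|flat_exp j t| <= j.+1`!%:R * `|t|.
Proof.
rewrite /flat_exp; case: ifPn => [t0|_]; last by rewrite normr0 mulr_ge0.
have s0 : 0 <= t^-1 by rewrite invr_ge0 ltW.
rewrite ger0_norm ?mulr_ge0 ?exprn_ge0 ?expR_ge0// (gtr0_norm t0).
rewrite expRN ler_pdivrMr ?expR_gt0//.
have C0 : 0 < j.+1`!%:R :> R by rewrite ltr0n fact_gt0.
have : t^-1 ^+ j.+1 <= j.+1`!%:R * expR t^-1.
  rewrite mulrC -ler_pdivrMr// (le_trans _ (expR_ge1Dxn j s0))//.
  by rewrite lerDr ler01.
rewrite -(ler_pM2l t0) exprS mulrA divff ?gt_eqF// mul1r.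
by rewrite mulrA (mulrC t).
Qed.

Lemma flat_exp0 j : flat_exp j 0 = 0.
Proof. by rewrite /flat_exp ltxx. Qed.

Lemma is_derive_flat_exp j t :
  is_derive t 1 (flat_exp j) (flat_exp j.+2 t - j%:R * flat_exp j.+1 t).
Proof.
have [t0|t0|<-] := ltgtP 0 t; first last.
- rewrite !flat_exp0 mulr0 subrr; apply/is_derive0P.
  apply/cvgr0Pnorm_le => e e0; near=> h.
  rewrite flat_exp0 subr0.
  (* For positive [h] the difference quotient at 0 is [flat_exp j.+1 h], which explains the
     factorial of [j.+2] in its linear bound. *)
  have C0 : 0 < j.+2`!%:R :> R by rewrite ltr0n fact_gt0.
  apply: (@le_trans _ _ (`|flat_exp j.+1 h|)).
    rewrite /flat_exp; case: ifP => _; last by rewrite mulr0.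
    by rewrite exprS mulrA.
  rewrite (le_trans (flat_exp_le _ _))// -ler_pdivlMl// mulrC.
  near: h; apply: dnbhs0_le; exact: divr_gt0.
- have -> : flat_exp j.+2 t - j%:R * flat_exp j.+1 t = 0.
    by rewrite /flat_exp !ifN ?mulr0 ?subrr// -leNgt ltW.
  apply: near_eq_is_derive (is_derive_cst 0 t 1).
  near=> u; rewrite /flat_exp ifN// -leNgt ltW//.
  by near: u; exact: lt_nbhsl.
- have tn0 : t != 0 by rewrite gt_eqF.
  have Hg : is_derive t^-1 1 (fun s : R => s ^+ j * expR (- s))
     (j%:R * t^-1 ^+ j.-1 * expR (- t^-1) - t^-1 ^+ j * expR (- t^-1)).
    have H1 := @is_derive1_comp R expR (fun s => - s) t^-1 _ _
      (is_derive_expR (- t^-1)) (is_deriveNid t^-1 1).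
    have H2 := @is_deriveX R R id j t^-1 1 1 (is_derive_id t^-1 1).
    have := is_deriveM H2 H1.
    rewrite (_ : (_ * _ : R -> R) = (fun s : R => s ^+ j * expR (- s))); last first.
      by apply/funext => s; rewrite fctE exprfctE.
    by move=> H; apply: is_derive_eq H _; rewrite /GRing.scale/= ?fctE; ring.
  have Hi : is_derive t 1 (@GRing.inv R) (- t^-1 ^+ 2).
    apply: is_derive_eq (is_deriveV tn0 (is_derive_id t 1)) _.
    by rewrite /GRing.scale/= mulr1 exprVn.
  have := is_derive1_comp Hg Hi.
  move=> H; apply: near_eq_is_derive.
    2: { apply: is_derive_eq H _. rewrite /flat_exp t0.
         by case: j {Hg} => [|j] /=; rewrite ?exprS; ring. }
  near=> u; rewrite /flat_exp ifT//.
  by near: u; exact: lt_nbhsr.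
Unshelve. all: by end_near. Qed.

Lemma smooth_on_flat_exp j : smooth_on setT (flat_exp j).
Proof.
move=> k; elim: k j => [|k IH] j.
  split=> // a _; apply: differentiable_continuous; apply/derivable1_diffP.
  by case: (is_derive_flat_exp j a).
apply: (@Ck_on_intro R R setT k (flat_exp j)
  (fun v t => (flat_exp j.+2 t + (- j%:R) * flat_exp j.+1 t) * v) openT).
- move=> a _; apply: differentiable_continuous; apply/derivable1_diffP.
  by case: (is_derive_flat_exp j a).
- by move=> v a _; apply: is_derive_dir; rewrite mulNr; exact: is_derive_flat_exp.
- move=> v; apply: Ck_onM; [exact: openT| |exact: Ck_on_cst openT].
  apply: Ck_onD; [exact: openT|exact: IH|].
  by apply: Ck_onM; [exact: openT|exact: Ck_on_cst openT|exact: IH].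
Qed.

(** A product of two one-sided flat functions, one vanishing left of [p], the other right of [q]. *)
Lemma exists_bump p q : exists chi : R -> R,
  [/\ smooth_on setT chi, (forall u, ~ `[p, q]%classic u -> chi u = 0) &
      (forall u, p < u < q -> chi u != 0)].
Proof.
exists (fun u => flat_exp 0 (u - p) * flat_exp 0 (q - u)); split.
- apply: smooth_onM; first exact: openT.
  + apply: (@smooth_on_comp _ _ _ openT setT (fun u => u - p)) => //.
      exact: smooth_on_flat_exp.
    apply: smooth_onB; [exact: openT|exact: smooth_on_id openT|].
    exact: (smooth_on_cst openT p).
  + apply: (@smooth_on_comp _ _ _ openT setT (fun u => q - u)) => //.
      exact: smooth_on_flat_exp.
    apply: smooth_onB; [exact: openT| |exact: smooth_on_id openT].
    exact: (smooth_on_cst openT q).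
- move=> u; rewrite /= in_itv/= => /negP; rewrite negb_and -!ltNge.
  rewrite /flat_exp !subr_gt0 => /orP[up|qu].
    by rewrite (ltNge p) (ltW up) mul0r.
  by rewrite (ltNge u) (ltW qu) mulr0.
- move=> u /andP[pu uq]; rewrite /flat_exp !subr_gt0 pu uq !expr0 !mul1r.
  by rewrite mulf_neq0// gt_eqF// expR_gt0.
Qed.

End Bump.

(** * One-parameter families of curves *)

Section TwoParameter.
Context {R : realType}.
Implicit Types (f g X Y : R * R -> R) (u e : R) (a : R * R).

Definition Du f a : R := 'D_((1, 0) : R * R) f a.
Definition De f a : R := 'D_((0, 1) : R * R) f a.

Lemma scale_fst_add u e h : h *: ((1, 0) : R * R) + (u, e) = (h + u, e).
Proof.
apply: injective_projections.
  exact: (congr1 (fun t => t + u) (mulr1 h)).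
exact: etrans (congr1 (+%R^~ e) (mulr0 h)) (add0r e).
Qed.

Lemma derive1_slice f u e : derive1 (fun u => f (u, e)) u = Du f (u, e).
Proof.
rewrite derive1E /Du (derive_line f) (derive_line (fun u => f (u, e))).
have -> : (fun h : R => f (h *: ((1, 0) : R * R) + (u, e))) =
    (fun h : R => f (h *: (1 : R) + u, e)); last by [].
by apply/funext => h; rewrite scale_fst_add [h%:A]mulr1.
Qed.

(** This and the next two are [speed], [Ds] and [kappa] as functions of both parameters, so that
    they can be differentiated in [e] and mixed derivatives can be swapped. *)
Definition speed2 X Y a : R := Num.sqrt (Du X a ^+ 2 + Du Y a ^+ 2).

Definition Ds2 X Y f a : R := Du f a / speed2 X Y a.

Definition kappa2 X Y m : R * R -> R := iter m (Ds2 X Y) (fun a =>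
  Ds2 X Y X a * Ds2 X Y (Ds2 X Y Y) a - Ds2 X Y Y a * Ds2 X Y (Ds2 X Y X) a).

Lemma speed_slice X Y u e :
  speed (fun u => X (u, e)) (fun u => Y (u, e)) u = speed2 X Y (u, e).
Proof. by rewrite /speed !derive1_slice. Qed.

Lemma Ds_slice X Y f e : Ds (fun u => X (u, e)) (fun u => Y (u, e))
  (fun u => f (u, e)) = (fun u => Ds2 X Y f (u, e)).
Proof. by apply/funext => u; rewrite /Ds derive1_slice speed_slice. Qed.

Lemma kappa_slice X Y m e : kappa (fun u => X (u, e)) (fun u => Y (u, e)) m =
  (fun u => kappa2 X Y m (u, e)).
Proof.
rewrite /kappa /kappa2; elim: m => [|m IH] /=; last by rewrite IH Ds_slice.
by apply/funext => u; rewrite /curvature !Ds_slice.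
Qed.

Definition density n (L : 'rV[R]_n.+1 -> R) X Y a : R :=
  L (\row_(m < n.+1) kappa2 X Y m a) * speed2 X Y a.

Lemma action_slice n (L : 'rV[R]_n.+1 -> R) p q X Y e :
  action L p q (fun u => X (u, e)) (fun u => Y (u, e)) =
  \int[lebesgue_measure]_(u in `[p, q]) density L X Y (u, e).
Proof.
apply: eq_Rintegral => u _; rewrite /density speed_slice; congr (L _ * _).
by apply/rowP => m; rewrite !mxE kappa_slice.
Qed.

Lemma De_val f a df : is_derive a ((0, 1) : R * R) f df -> De f a = df.
Proof. by case. Qed.

Lemma De_is_derive (V : set (R * R)) f a : smooth_on V f -> V a ->
  is_derive a ((0, 1) : R * R) f (De f a).
Proof. exact: smooth_on_is_derive. Qed.

Lemma smooth_on_De (V : set (R * R)) f : smooth_on V f -> smooth_on V (De f).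
Proof. exact: smooth_on_derive. Qed.

Lemma DeM (V : set (R * R)) f g a : smooth_on V f -> smooth_on V g -> V a ->
  De (fun a => f a * g a) a = f a * De g a + g a * De f a.
Proof.
move=> sf sg Va.
exact: De_val (is_deriveM (De_is_derive sf Va) (De_is_derive sg Va)).
Qed.

Lemma DeB (V : set (R * R)) f g a : smooth_on V f -> smooth_on V g -> V a ->
  De (fun a => f a - g a) a = De f a - De g a.
Proof.
move=> sf sg Va.
exact: De_val (is_deriveB (De_is_derive sf Va) (De_is_derive sg Va)).
Qed.

Lemma De_chain n (L : 'rV[R]_n -> R) (F : 'I_n -> R * R -> R) (V : set (R * R)) a :
  smooth_on setT L -> (forall m, smooth_on V (F m)) -> V a ->
  De (fun a => L (\row_m F m a)) a =
  \sum_m 'D_(delta_mx 0 m) L (\row_m F m a) * De (F m) a.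
Proof.
move=> sL sF Va; apply: De_val.
have HL := @is_derive_chain _ _ _ L (fun a => \row_m F m a)
  a ((0, 1) : R * R) (fun m => De (F m) a) sL.
apply: HL => m; have -> : (fun a => (\row_m F m a) 0 m) = F m.
  by apply/funext => b; rewrite mxE.
exact: De_is_derive (sF m) Va.
Qed.

Lemma De_slice (V : set (R * R)) f u : smooth_on V f -> V (u, 0) ->
  De f (u, 0) = 'D_1 (fun e : R => f (u, e)) 0.
Proof. by move=> sf Va; case: (is_derive_slice sf Va) => _ ->. Qed.

Lemma smooth_on_slice (I : set R) (V : set (R * R)) f : open I ->
  (forall u, I u -> V (u, 0)) ->
  smooth_on V f -> smooth_on I (fun u => f (u, 0)).
Proof.
move=> oI V0 sf k; elim: k f sf => [|k IH] f sf.
  split=> // u Iu; apply: (@continuous_comp _ _ _ (fun u : R => (u, 0 : R)) f).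
    move=> A [[B C] [/= Bu C0] BCA]; apply: filterS Bu => v Bv.
    by apply: BCA; split=> //; exact: nbhs_singleton C0.
  exact: smooth_on_continuous sf (V0 _ Iu).
apply: (@Ck_on_intro R R I k (fun u => f (u, 0))
  (fun v u => Du f (u, 0) * v) oI).
- move=> u Iu; apply: (@continuous_comp _ _ _ (fun u : R => (u, 0 : R)) f).
    move=> A [[B C] [/= Bu C0] BCA]; apply: filterS Bu => v Bv.
    by apply: BCA; split=> //; exact: nbhs_singleton C0.
  exact: smooth_on_continuous sf (V0 _ Iu).
- move=> v u Iu; apply: is_derive_dir.
  have -> : (fun u => f (u, 0)) =
      (fun h : R => f (h *: ((1, 0) : R * R) + (0, 0))).
    by apply/funext => h; rewrite scale_fst_add addr0.
  apply: is_derive_line_at; rewrite scale_fst_add addr0.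
  exact: smooth_on_is_derive sf (V0 _ Iu).
- move=> v; apply: Ck_onM => //; last exact: Ck_on_cst.
  apply: (IH (Du f)); exact: smooth_on_derive.
Qed.

Variables (U : set (R * R)) (oU : open U) (X Y : R * R -> R).
Hypotheses (sX : smooth_on U X) (sY : smooth_on U Y).

(** Excludes the points where the deformed curves have zero speed and their curvatures may fail to
    be smooth; the slice [e = 0] of a unit speed curve stays inside. *)
Definition regular : set (R * R) :=
  [set a | U a /\ 0 < Du X a ^+ 2 + Du Y a ^+ 2].

Lemma smooth_on_speed2_sqr :
  smooth_on U (fun a => Du X a ^+ 2 + Du Y a ^+ 2).
Proof.
by apply: smooth_onD => //; apply: smooth_onX => //; exact: smooth_on_derive.
Qed.

Lemma open_regular : open regular.
Proof.
rewrite openE => a [Ua a0]; apply: filterI.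
  exact: open_nbhs_nbhs.
have := smooth_on_continuous smooth_on_speed2_sqr Ua.
by move=> /cvgr_gt; exact.
Qed.

Lemma sub_regular f : smooth_on U f -> smooth_on regular f.
Proof. by apply: sub_smooth_on => a []. Qed.

Lemma speed2_gt0 a : regular a -> 0 < speed2 X Y a.
Proof. by case=> _ a0; rewrite sqrtr_gt0. Qed.

Lemma smooth_on_speed2 : smooth_on regular (speed2 X Y).
Proof.
apply: (smooth_on_comp open_regular _ smooth_on_sqrt).
  by move=> a [].
exact: sub_regular smooth_on_speed2_sqr.
Qed.

Lemma smooth_on_speed2V : smooth_on regular (fun a => (speed2 X Y a)^-1).
Proof.
apply: (smooth_on_comp open_regular _ smooth_on_inv smooth_on_speed2).
by move=> a /speed2_gt0 a0; rewrite /= gt_eqF.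
Qed.

Lemma smooth_on_Ds2 f : smooth_on regular f -> smooth_on regular (Ds2 X Y f).
Proof.
move=> sf; apply: (smooth_onM open_regular); last exact: smooth_on_speed2V.
exact: smooth_on_derive.
Qed.

Lemma smooth_on_kappa2 m : smooth_on regular (kappa2 X Y m).
Proof.
elim: m => [|m IH] /=; last exact: smooth_on_Ds2.
have rX := sub_regular sX; have rY := sub_regular sY.
by apply: (smooth_onB open_regular); apply: (smooth_onM open_regular);
  do ?apply: smooth_on_Ds2.
Qed.

Lemma smooth_on_density n (L : 'rV[R]_n.+1 -> R) : smooth_on setT L ->
  smooth_on regular (density L X Y).
Proof.
move=> sL; apply: (smooth_onM open_regular); last exact: smooth_on_speed2.
apply: (smooth_on_chain open_regular sL) => m.
apply: (eq_smooth_on open_regular _ (smooth_on_kappa2 m)) => a _.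
by rewrite mxE.
Qed.

Lemma De_speed2 a : regular a -> speed2 X Y a = 1 ->
  De (speed2 X Y) a = Du X a * Du (De X) a + Du Y a * Du (De Y) a.
Proof.
move=> ra s1; have [Ua a0] := ra.
have HX := smooth_on_is_derive ((0, 1) : R * R) (smooth_on_derive ((1, 0) : R * R) sX) Ua.
have HY := smooth_on_is_derive ((0, 1) : R * R) (smooth_on_derive ((1, 0) : R * R) sY) Ua.
have := is_derive_comp1 (is_deriveD (is_deriveX 2 HX) (is_deriveX 2 HY))
  (is_derive1_sqrt a0).
move=> [_]; rewrite /De => ->.
rewrite -[Num.sqrt _]/(speed2 X Y a) s1 /GRing.scale/=.
rewrite /Du (derive_swap _ _ oU sX Ua) (derive_swap _ _ oU sY Ua).
by rewrite !expr1 -!mulrA -mulrDr mulr1 mulKf ?pnatr_eq0.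
Qed.

(** [De] commutes with [Du] but not with division by the speed, which varies too; as the speed is 1
    at [a], its reciprocal varies by minus [De (speed2 X Y) a]. *)
Lemma De_Ds2 f a : smooth_on regular f -> regular a -> speed2 X Y a = 1 ->
  De (Ds2 X Y f) a = Du (De f) a - De (speed2 X Y) a * Du f a.
Proof.
move=> sf ra s1.
have Hf := smooth_on_is_derive ((0, 1) : R * R) (smooth_on_derive ((1, 0) : R * R) sf) ra.
have Hs := smooth_on_is_derive ((0, 1) : R * R) smooth_on_speed2 ra.
have HI : is_derive (speed2 X Y a) 1 (@GRing.inv R) (- 1).
  rewrite s1.
  have := is_deriveV (f := id) (oner_neq0 R) (is_derive_id (1 : R) (1 : R)).
  by rewrite /= expr1n invr1 /GRing.scale/= mulr1.
have HV := is_derive_comp1 Hs HI.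
have [_] := is_deriveM Hf HV.
rewrite /De => ->.
rewrite /= s1 /GRing.scale/= !(invr1, expr1n, mulr1, mul1r, mulN1r).
by rewrite /Du (derive_swap _ _ open_regular sf ra) addrC mulrN mulrC.
Qed.

End TwoParameter.

(** * Calculus along a unit speed curve *)

Section UnitSpeedCurve.
Context {R : realType}.
Variables (I : set R) (oI : open I) (x y : R -> R).
Hypotheses (sx : smooth_on I x) (sy : smooth_on I y).
Hypothesis unit_speed : forall s, I s -> derive1 x s ^+ 2 + derive1 y s ^+ 2 = 1.
Implicit Types (f g h P a b : R -> R) (u p q : R).

Local Notation D := (Ds x y).
Local Notation K := (curvature x y).
Local Notation kap := (kappa x y).

Lemma Ds_derive1 f u : I u -> D f u = derive1 f u.
Proof. by move=> Iu; rewrite /Ds /speed unit_speed// sqrtr1 divr1. Qed.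

Lemma Ds_is_derive f u : smooth_on I f -> I u -> is_derive u 1 f (D f u).
Proof.
move=> sf Iu; rewrite Ds_derive1// derive1E; exact: smooth_on_is_derive sf Iu.
Qed.

Lemma eq_Ds f g u : (forall s, I s -> f s = g s) -> I u -> D f u = D g u.
Proof.
move=> fg Iu; rewrite !Ds_derive1// !derive1E; apply: near_eq_derive.
exact: near_open_eq Iu.
Qed.

Lemma smooth_on_Ds f : smooth_on I f -> smooth_on I (D f).
Proof.
move=> sf; apply: (eq_smooth_on oI _ (smooth_on_derive (1 : R) sf)) => u Iu.
by rewrite Ds_derive1// derive1E.
Qed.

Lemma smooth_on_iter_Ds f m : smooth_on I f -> smooth_on I (iter m D f).
Proof. by move=> sf; elim: m => [|m IH] //=; exact: smooth_on_Ds. Qed.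

Lemma DsD f g u : smooth_on I f -> smooth_on I g -> I u ->
  D (fun u => f u + g u) u = D f u + D g u.
Proof.
move=> sf sg Iu; rewrite Ds_derive1// derive1E.
by case: (is_deriveD (Ds_is_derive sf Iu) (Ds_is_derive sg Iu)).
Qed.

Lemma DsN f u : smooth_on I f -> I u -> D (fun u => - f u) u = - D f u.
Proof.
move=> sf Iu; rewrite Ds_derive1// derive1E.
by case: (is_deriveN (Ds_is_derive sf Iu)).
Qed.

Lemma DsB f g u : smooth_on I f -> smooth_on I g -> I u ->
  D (fun u => f u - g u) u = D f u - D g u.
Proof. by move=> sf sg Iu; rewrite DsD ?DsN//; exact: smooth_onN. Qed.

Lemma DsM f g u : smooth_on I f -> smooth_on I g -> I u ->
  D (fun u => f u * g u) u = D f u * g u + f u * D g u.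
Proof.
move=> sf sg Iu; rewrite Ds_derive1// derive1E.
case: (is_deriveM (Ds_is_derive sf Iu) (Ds_is_derive sg Iu)) => _ ->.
by rewrite /GRing.scale/= addrC (mulrC (g u)).
Qed.

Lemma Ds_cst (c : R) u : I u -> D (fun=> c) u = 0.
Proof. by move=> Iu; rewrite Ds_derive1// derive1_cst. Qed.

Lemma DsZ (c : R) f u : smooth_on I f -> I u -> D (fun u => c * f u) u = c * D f u.
Proof.
move=> sf Iu; rewrite DsM ?Ds_cst ?mul0r ?add0r//; exact: (smooth_on_cst oI c).
Qed.

Lemma Ds_sum (T : Type) (r : seq T) (Q : pred T) (F : T -> R -> R) u :
  (forall i, Q i -> smooth_on I (F i)) -> I u ->
  D (fun u => \sum_(i <- r | Q i) F i u) u = \sum_(i <- r | Q i) D (F i) u.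
Proof.
move=> sF Iu; elim: r => [|i r IH].
  rewrite big_nil; apply: etrans (Ds_cst 0 Iu).
  by apply: eq_Ds => // s _; rewrite big_nil.
rewrite big_cons; case: ifP => Qi.
  rewrite -IH -DsD//; [|exact: sF|exact: smooth_on_sum].
  by apply: eq_Ds => // s _; rewrite big_cons Qi.
by rewrite -IH; apply: eq_Ds => // s _; rewrite big_cons Qi.
Qed.

Lemma tangent_unit u : I u -> D x u ^+ 2 + D y u ^+ 2 = 1.
Proof. by move=> Iu; rewrite !Ds_derive1// unit_speed. Qed.

Lemma smooth_on_curvature : smooth_on I K.
Proof.
by apply: smooth_onB => //; apply: smooth_onM => //; do ?apply: smooth_on_Ds.
Qed.

Lemma smooth_on_kappa m : smooth_on I (kap m).
Proof. exact/smooth_on_iter_Ds/smooth_on_curvature. Qed.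

(** Differentiating the unit speed identity makes the acceleration orthogonal to the tangent, hence
    a multiple of the normal; the factor is the curvature by definition. *)
Lemma frenet u : I u -> D (D x) u = - (K u * D y u) /\ D (D y) u = K u * D x u.
Proof.
move=> Iu.
have s1 := smooth_on_Ds sx; have s2 := smooth_on_Ds sy.
have T := tangent_unit Iu.
have : D (fun u => D x u ^+ 2 + D y u ^+ 2) u = 0.
  by apply: etrans (Ds_cst 1 Iu); apply: eq_Ds => // s Is; exact: tangent_unit.
rewrite DsD//; try by apply: smooth_onM.
rewrite (@DsM (D x) (D x))// (@DsM (D y) (D y))// /curvature.
move: (D x u) (D y u) (D (D x) u) (D (D y) u) T => a b a' b' T O.
have O' : a * a' + b * b' = 0 by lra.
split.
  have -> : - ((a * b' - b * a') * b) =
    a' * (a ^+ 2 + b ^+ 2) - a * (a * a' + b * b') by ring.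
  by rewrite T O' mulr1 mulr0 subr0.
have -> : (a * b' - b * a') * a =
    b' * (a ^+ 2 + b ^+ 2) - b * (a * a' + b * b') by ring.
by rewrite T O' mulr1 mulr0 subr0.
Qed.

(* Being [exact_congr] forces equal integrals over [[p, q]]. *)
Definition flat p q f := smooth_on I f /\
  (forall u, I u -> ~ `[p, q]%classic u -> f u = 0).

Definition exact_congr p q f g := exists h, flat p q h /\
  (forall u, I u -> f u = g u + D h u).

Lemma flat_cst0 p q : flat p q (fun=> 0).
Proof. by split=> //; exact: (smooth_on_cst oI 0). Qed.

Lemma flatD p q f g : flat p q f -> flat p q g -> flat p q (fun u => f u + g u).
Proof.
move=> [sf zf] [sg zg]; split; first exact: smooth_onD.
by move=> u Iu nu; rewrite zf// zg// addr0.
Qed.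

Lemma flatM p q f g : smooth_on I f -> flat p q g -> flat p q (fun u => f u * g u).
Proof.
move=> sf [sg zg]; split; first exact: smooth_onM.
by move=> u Iu nu; rewrite zg// mulr0.
Qed.

Lemma flatN p q f : flat p q f -> flat p q (fun u => - f u).
Proof.
move=> [sf zf]; split; first exact: smooth_onN.
by move=> u Iu nu; rewrite zf// oppr0.
Qed.

Lemma flat_Ds p q f : flat p q f -> flat p q (D f).
Proof.
move=> [sf zf]; split; first exact: smooth_on_Ds.
move=> u Iu nu; apply: etrans (Ds_cst 0 Iu); rewrite !Ds_derive1// !derive1E.
have oZ : open (I `&` ~` `[p, q]).
  by apply: openI => //; apply: closed_openC; exact: itv_closed.
apply: near_eq_derive; apply: (near_open_eq oZ) => [b [Ib nb]|]; last by split.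
exact: zf.
Qed.

(** As [I] is open, an endpoint in it is a limit of points of [I] outside the segment, where [f]
    vanishes; continuity concludes. Boundary terms disappear for this reason. *)
Lemma flat_boundary p q f u : flat p q f -> I u -> (u = p \/ u = q) -> f u = 0.
Proof.
move=> [sf zf] Iu upq; apply/eqP; apply/negPn/negP => fu0.
have : nbhs u (fun t => I t /\ f t != 0).
  apply: filterI; first exact: open_nbhs_nbhs.
  exact: (cvgr_neq0 _ (smooth_on_continuous sf Iu) fu0).
move=> /nbhs_ballP[r /= r0 H].
have near_u (t : R) : `|u - t| < r -> ~ `[p, q]%classic t -> False.
  by move=> /H[It /eqP ft] nt; apply: ft; exact: zf.
case: upq => E; [apply: (near_u (u - r / 2))|apply: (near_u (u + r / 2))];
  rewrite ?E /= ?in_itv/=.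
- by rewrite opprB addrC subrK ger0_norm; lra.
- by move=> /andP[? _]; lra.
- by rewrite opprD addrA subrr add0r normrN ger0_norm; lra.
- by move=> /andP[_ ?]; lra.
Qed.

Lemma exact_congr_eq p q f g : (forall u, I u -> f u = g u) -> exact_congr p q f g.
Proof.
move=> fg; exists (fun=> 0); split; first exact: flat_cst0.
by move=> u Iu; rewrite fg// Ds_cst// addr0.
Qed.

Lemma exact_congr_trans p q g f h :
  exact_congr p q f g -> exact_congr p q g h -> exact_congr p q f h.
Proof.
move=> [k [zk fk]] [l [zl gl]]; exists (fun u => l u + k u); split; first exact: flatD.
move=> u Iu; rewrite fk// gl// DsD; [|by case: zl|by case: zk|exact: Iu].
exact: (esym (addrA _ _ _)).
Qed.

Lemma exact_congrD p q f g f' g' : exact_congr p q f f' -> exact_congr p q g g' ->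
  exact_congr p q (fun u => f u + g u) (fun u => f' u + g' u).
Proof.
move=> [k [zk fk]] [l [zl gl]]; exists (fun u => k u + l u); split; first exact: flatD.
move=> u Iu; rewrite fk// gl// DsD; [exact: addrACA|by case: zk|by case: zl|].
exact: Iu.
Qed.

Lemma exact_congrN p q f f' : exact_congr p q f f' ->
  exact_congr p q (fun u => - f u) (fun u => - f' u).
Proof.
move=> [k [zk fk]]; exists (fun u => - k u); split; first exact: flatN.
move=> u Iu; rewrite fk// DsN; [exact: opprD|by case: zk|exact: Iu].
Qed.

Lemma exact_congr_sum p q (T : Type) (r : seq T) (F G : T -> R -> R) :
  (forall i, exact_congr p q (F i) (G i)) ->
  exact_congr p q (fun u => \sum_(i <- r) F i u) (fun u => \sum_(i <- r) G i u).
Proof.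
move=> FG; elim: r => [|i r IH].
  by apply: exact_congr_eq => u _; rewrite !big_nil.
apply: (@exact_congr_trans p q (fun u => F i u + \sum_(j <- r) F j u)).
  by apply: exact_congr_eq => u _; rewrite big_cons.
apply: exact_congr_trans; first exact: exact_congrD (FG i) IH.
by apply: exact_congr_eq => u _; rewrite big_cons.
Qed.

(** Integration by parts: the discarded derivative is that of [P u * h u], which vanishes wherever
    [h] does. *)
Lemma exact_congr_parts p q P h : smooth_on I P -> flat p q h ->
  exact_congr p q (fun u => P u * D h u) (fun u => - (D P u * h u)).
Proof.
move=> sP zh; exists (fun u => P u * h u); split; first exact: flatM.
by move=> u Iu; rewrite DsM//; [rewrite addrA addNr add0r|case: zh].
Qed.

Lemma Rintegral_exact_congr p q f g : smooth_on I g -> `[p, q] `<=` I -> p < q ->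
  exact_congr p q f g ->
  \int[lebesgue_measure]_(u in `[p, q]) f u =
  \int[lebesgue_measure]_(u in `[p, q]) g u.
Proof.
move=> sg pqI pq [h [zh fgh]].
have Ip : I p by apply: pqI; rewrite /= in_itv/= lexx ltW.
have Iq : I q by apply: pqI; rewrite /= in_itv/= lexx ltW.
apply: (@Rintegral_congr_exact R I f g h p q sg) => //.
- by case: zh.
- by apply: flat_boundary zh Ip _; left.
- by apply: flat_boundary zh Iq _; right.
- by move=> u Iu; rewrite fgh// Ds_derive1.
Qed.

(* A displacement with tangential component [a] and normal component [b] changes
   [kappa x y m] by [a * kappa x y m.+1 + normal_jet b m] to first order. *)
Fixpoint normal_jet b m : R -> R :=
  match m with
  | 0 => fun u => D (D b) u + K u ^+ 2 * b u
  | m.+1 => fun u => D (normal_jet b m) u + K u * b u * kap m.+1 u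
  end.

Lemma flat_normal_jet p q b m : flat p q b -> flat p q (normal_jet b m).
Proof.
move=> zb; elim: m => [|m IH] /=; apply: flatD.
- exact/flat_Ds/flat_Ds.
- by apply: flatM => //; apply: smooth_onX => //; exact: smooth_on_curvature.
- exact: flat_Ds.
- have [s z] := flatM (smooth_onM oI (smooth_on_kappa m.+1) smooth_on_curvature) zb.
  split; first by apply: (eq_smooth_on oI _ s) => u _; rewrite -mulrA mulrC.
  by move=> u Iu nu; apply: etrans (z u Iu nu); rewrite -[RHS]mulrA mulrC.
Qed.

(** One integration by parts per level: the derivative in [normal_jet b m.+1] moves onto [P], and
    the other summand leaves a multiple of [K u * b u]. With the partial derivatives of [L] for [P],
    these leftovers add up to [double_sum]. The two derivatives inside [normal_jet b 0] wait until
    [euler_op] has been assembled. *)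
Lemma exact_congr_normal_jet p q P b m : smooth_on I P -> flat p q b ->
  exact_congr p q (fun u => P u * normal_jet b m u)
    (fun u => (-1) ^+ m * iter m D P u * normal_jet b 0 u +
      \sum_(0 <= j < m) (-1) ^+ j * iter j D P u * kap (m - j) u * (K u * b u)).
Proof.
move=> + zb; elim: m P => [|m IH] P sP.
  by apply: exact_congr_eq => u _; rewrite big_geq// expr0 mul1r addr0.
apply: (@exact_congr_trans p q (fun u => P u * D (normal_jet b m) u +
    P u * kap m.+1 u * (K u * b u))).
  by apply: exact_congr_eq => u _ /=; ring.
apply: (@exact_congr_trans p q (fun u => - (D P u * normal_jet b m u) +
    P u * kap m.+1 u * (K u * b u))).
  apply: exact_congrD; last exact: exact_congr_eq.
  by apply: exact_congr_parts => //; exact: flat_normal_jet.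
apply: exact_congr_trans.
  apply: exact_congrD; last exact: exact_congr_eq.
  by apply: exact_congrN; apply: IH; exact: smooth_on_Ds.
apply: exact_congr_eq => u Iu.
(* The leftover of the current level is the term [j = 0]; those of the induction hypothesis, taken
   for [D P], shift to [j.+1]. *)
rewrite big_nat_recl// subn0 expr0 mul1r -iterSr exprS.
rewrite opprD -sumrN addrAC -addrA; congr (_ + (_ + _)).
  by rewrite mulN1r !mulNr.
apply: eq_bigr => j _; rewrite -iterSr subSS exprS; ring.
Qed.

End UnitSpeedCurve.

(** * The Euler-Lagrange expression and the Noether currents *)

Section EulerLagrange.
Context {R : realType}.
Variables (n : nat) (L : 'rV[R]_n.+1 -> R).
Hypothesis sL : smooth_on [set: 'rV[R]_n.+1] L.
Variables (I : set R) (oI : open I) (x y : R -> R).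
Hypotheses (sx : smooth_on I x) (sy : smooth_on I y).
Hypothesis unit_speed : forall s, I s -> derive1 x s ^+ 2 + derive1 y s ^+ 2 = 1.
Implicit Types (a b : R -> R) (u p q : R).

Local Notation D := (Ds x y).
Local Notation K := (curvature x y).
Local Notation kap := (kappa x y).
Local Notation E := (euler_op L x y).
Local Notation Lj := (fun u => L (kappa_jet n x y u)).

Let smooth_D f : smooth_on I f -> smooth_on I (D f).
Proof. exact: smooth_on_Ds. Qed.

Let smooth_kap m : smooth_on I (kap m).
Proof. exact: smooth_on_kappa. Qed.

Let smooth_K : smooth_on I K. Proof. exact: (smooth_kap 0). Qed.

Let smooth_jet m : smooth_on I (fun u => kappa_jet n x y u 0 m).
Proof.
by apply: (eq_smooth_on oI _ (smooth_kap m)) => u _; rewrite mxE.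
Qed.

Lemma smooth_on_dL m : smooth_on I (dL L x y m).
Proof.
apply: (smooth_on_chain oI _ smooth_jet (L := 'D_(delta_mx 0 m) L)).
exact: smooth_on_derive.
Qed.

Let smooth_iter_dL j m : smooth_on I (iter j D (dL L x y m)).
Proof. by apply: smooth_on_iter_Ds => //; exact: smooth_on_dL. Qed.

Lemma smooth_on_Lagrangian : smooth_on I Lj.
Proof. exact: smooth_on_chain. Qed.

Lemma Ds_Lagrangian u : I u -> D Lj u = \sum_m dL L x y m u * kap m.+1 u.
Proof.
move=> Iu; rewrite (Ds_derive1 unit_speed)// derive1E.
have [|_ ->] := @is_derive_chain _ _ _ L (kappa_jet n x y) u 1
    (fun m => kap m.+1 u) sL; last by [].
move=> m; have -> : (fun s => kappa_jet n x y s 0 m) = kap m.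
  by apply/funext => s; rewrite mxE.
exact: (Ds_is_derive unit_speed (smooth_kap m) Iu).
Qed.

Lemma smooth_on_euler_op : smooth_on I E.
Proof.
apply: smooth_on_sum => // m _; apply: smooth_onM => //.
exact: (smooth_on_cst oI).
Qed.

Lemma smooth_on_double_sum : smooth_on I (double_sum L x y).
Proof.
apply: smooth_on_sum => // m _; apply: smooth_on_sum => // j _.
apply: smooth_onM => //; apply: smooth_onM => //; exact: (smooth_on_cst oI).
Qed.

Lemma smooth_on_lambda : smooth_on I (lambda L x y).
Proof.
apply: smooth_onD => //; last exact: smooth_on_double_sum.
by apply: smooth_onN => //; exact: smooth_on_Lagrangian.
Qed.

Lemma smooth_on_EL : smooth_on I (EL L x y).
Proof.
have sE := smooth_on_euler_op.
apply: smooth_onB => //.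
  apply: smooth_onD => //; first exact/smooth_D/smooth_D.
  by apply: smooth_onM => //; exact: smooth_onX.
apply: smooth_onM => //; apply: smooth_onB => //.
  exact: smooth_on_Lagrangian.
exact: smooth_on_double_sum.
Qed.

Lemma double_sumE u : double_sum L x y u = \sum_(m < n.+1) \sum_(0 <= j < m)
  (-1) ^+ j * iter j D (dL L x y m) u * kap (m - j) u.
Proof.
rewrite /double_sum big_mkcond; apply: eq_bigr => m _.
by case: ifPn => //; rewrite -leqNgt leqn0 => /eqP ->; rewrite big_geq.
Qed.

(* The derivative of each inner sum telescopes. *)
Lemma Ds_double_sum u : I u ->
  D (double_sum L x y) u = D Lj u - kap 1 u * E u.
Proof.
move=> Iu; rewrite Ds_Lagrangian// /euler_op mulr_sumr -sumrB.
pose F (m : 'I_n.+1) u := \sum_(0 <= j < m)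
  (-1) ^+ j * iter j D (dL L x y m) u * kap (m - j) u.
have sF (m : 'I_n.+1) j :
    smooth_on I (fun u => (-1) ^+ j * iter j D (dL L x y m) u * kap (m - j) u).
  apply: smooth_onM => //; apply: smooth_onM => //; exact: (smooth_on_cst oI).
have -> : D (double_sum L x y) u = D (fun u => \sum_m F m u) u.
  by apply: (eq_Ds oI unit_speed _ Iu) => s _; exact: double_sumE.
rewrite (Ds_sum oI unit_speed)//; last by move=> m _; exact: smooth_on_sum.
apply: eq_bigr => m _; rewrite /F (Ds_sum oI unit_speed)//.
(* The [j]-th term has derivative [G j - G j.+1]; [G 0] is the contribution to the derivative of
   [L], and [G m] the one to [kap 1 u * E u]. *)
pose G j := (-1) ^+ j * iter j D (dL L x y m) u * kap (m - j).+1 u.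
have -> : dL L x y m u * kap m.+1 u - kap 1 u * ((-1) ^+ m * iter m D (dL L x y m) u)
    = - (G m - G 0%N).
  by rewrite /G subnn subn0 expr0 mul1r opprB; congr (_ - _); exact: mulrC.
rewrite -telescope_sumr// -sumrN; apply: eq_big_nat => j /andP[_ jm].
rewrite (DsM unit_speed)//; last first.
  by apply: smooth_onM => //; exact: (smooth_on_cst oI).
rewrite (DsZ oI unit_speed)// /G subnSK// opprB addrC; congr (_ + _).
by rewrite exprS mulN1r !mulNr opprK.
Qed.

Lemma Ds_lambda u : I u -> D (lambda L x y) u = - (kap 1 u * E u).
Proof.
move=> Iu; rewrite (DsD unit_speed)//; last 2 first.
- by apply: smooth_onN => //; exact: smooth_on_Lagrangian.
- exact: smooth_on_double_sum.
rewrite (DsN unit_speed)//; last exact: smooth_on_Lagrangian.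
by rewrite Ds_double_sum// addrA addNr add0r.
Qed.

Lemma EL_lambda u :
  D (D E) u = EL L x y u - K u ^+ 2 * E u - K u * lambda L x y u.
Proof. by rewrite /EL /lambda; ring. Qed.

Definition current (i : 'I_3) u : R :=
  (noether_matrix x y u *m noether_vector L x y u) i 0.

(** The rotation current is the moment of the two translation currents plus the intrinsic term
    [E u], so its derivative reduces to theirs. *)
Lemma current_spec u :
  [/\ current 0 u = D x u * (- lambda L x y u - K u * E u) + D y u * D E u,
      current 1 u = D y u * (- lambda L x y u - K u * E u) - D x u * D E u &
      current 2%:R u = x u * current 1 u - y u * current 0 u + E u].
Proof.
have E3 i : current i u = noether_matrix x y u i 0 * noether_vector L x y u 0 0
   + noether_matrix x y u i 1 * noether_vector L x y u 1 0
   + noether_matrix x y u i 2%:R * noether_vector L x y u 2%:R 0.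
  rewrite /current mxE !big_ord_recl big_ord0 addr0 addrA.
  by congr (_ * _ + _ * _ + _ * _); congr (fun_of_matrix _ _ _); apply/val_inj.
by rewrite !E3 !mxE /=; split; ring.
Qed.

Lemma smooth_on_current i : smooth_on I (current i).
Proof.
have sE := smooth_on_euler_op; have sl := smooth_on_lambda.
have sA : smooth_on I (fun u => - lambda L x y u - K u * E u).
  by apply: smooth_onB => //; [exact: smooth_onN|exact: smooth_onM].
have s0 : smooth_on I (current 0).
  apply: (@eq_smooth_on _ _ I oI (fun u =>
    D x u * (- lambda L x y u - K u * E u) + D y u * D E u)).
    by move=> u _; case: (current_spec u).
  by apply: smooth_onD => //; apply: smooth_onM => //; exact: smooth_D.
have s1 : smooth_on I (current 1).
  apply: (@eq_smooth_on _ _ I oI (fun u =>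
    D y u * (- lambda L x y u - K u * E u) - D x u * D E u)).
    by move=> u _; case: (current_spec u).
  by apply: smooth_onB => //; apply: smooth_onM => //; exact: smooth_D.
have s2 : smooth_on I (current 2%:R).
  apply: (@eq_smooth_on _ _ I oI (fun u =>
    x u * current 1 u - y u * current 0 u + E u)).
    by move=> u _; case: (current_spec u).
  by apply: smooth_onD => //; apply: smooth_onB => //; exact: smooth_onM.
case: i => [[|[|[|//]]] i].
- by rewrite (_ : Ordinal i = 0)//; exact/val_inj.
- by rewrite (_ : Ordinal i = 1)//; exact/val_inj.
- by rewrite (_ : Ordinal i = 2%:R)//; exact/val_inj.
Qed.

(** In the moving frame the translation currents have components A = - lambda - K E and B = - D E.
    [Ds_lambda] gives A' = K B, so by the Frenet equations the tangential part of the derivative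
    cancels; [EL_lambda] identifies the normal part. *)
Lemma Ds_current01 u : I u ->
  D (current 0) u = D y u * EL L x y u /\ D (current 1) u = - (D x u * EL L x y u).
Proof.
move=> Iu; have sE := smooth_on_euler_op; have sl := smooth_on_lambda.
have sA : smooth_on I (fun u => - lambda L x y u - K u * E u).
  by apply: smooth_onB => //; [exact: smooth_onN|exact: smooth_onM].
have [T1 T2] := frenet oI sx sy unit_speed Iu.
have DA : D (fun u => - lambda L x y u - K u * E u) u = - (K u * D E u).
  rewrite (DsB oI unit_speed)//; [|exact: smooth_onN|exact: smooth_onM].
  rewrite (DsN unit_speed)// Ds_lambda// (DsM unit_speed)//.
  by rewrite -[D K u]/(kap 1 u) opprK opprD addNKr.
have DB := EL_lambda u.
split.
  have -> : D (current 0) u = D (fun u =>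
      D x u * (- lambda L x y u - K u * E u) + D y u * D E u) u.
    by apply: (eq_Ds oI unit_speed _ Iu) => s _; case: (current_spec s).
  rewrite (DsD unit_speed)//; [|by apply: smooth_onM; rewrite //; exact: smooth_D..].
  rewrite (DsM unit_speed)//; [|exact: smooth_D].
  rewrite (DsM unit_speed)//; [|exact: smooth_D..].
  by rewrite DA T1 T2 DB; ring.
have -> : D (current 1) u = D (fun u =>
    D y u * (- lambda L x y u - K u * E u) - D x u * D E u) u.
  by apply: (eq_Ds oI unit_speed _ Iu) => s _; case: (current_spec s).
rewrite (DsB oI unit_speed)//; [|by apply: smooth_onM; rewrite //; exact: smooth_D..].
rewrite (DsM unit_speed)//; [|exact: smooth_D].
rewrite (DsM unit_speed)//; [|exact: smooth_D..].
by rewrite DA T1 T2 DB; ring.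
Qed.

Lemma Ds_current i u : I u -> D (current i) u =
  - ((D x u * (se2_generator i (x u) (y u)).2
      - D y u * (se2_generator i (x u) (y u)).1) * EL L x y u).
Proof.
move=> Iu; have sE := smooth_on_euler_op.
have [D0 D1] := Ds_current01 Iu.
case: i => [[|[|[|//]]] i].
- rewrite (_ : se2_generator _ _ _ = (1, 0))// (_ : Ordinal i = 0); last exact/val_inj.
  by rewrite D0 /= mulr0 mulr1 sub0r mulNr opprK.
- rewrite (_ : se2_generator _ _ _ = (0, 1))// (_ : Ordinal i = 1); last exact/val_inj.
  by rewrite D1 /= mulr0 mulr1 subr0.
rewrite (_ : se2_generator _ _ _ = (- y u, x u))//.
rewrite (_ : Ordinal i = 2%:R); last exact/val_inj.
have -> : D (current 2%:R) u = D (fun u =>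
    x u * current 1 u - y u * current 0 u + E u) u.
  by apply: (eq_Ds oI unit_speed _ Iu) => s _; case: (current_spec s).
have sc := smooth_on_current.
rewrite (DsD unit_speed)//; [|by apply: smooth_onB => //; exact: smooth_onM].
rewrite (DsB oI unit_speed)//; [|exact: smooth_onM..].
rewrite !(DsM unit_speed)// D0 D1.
have [-> -> _] := current_spec u.
have T := tangent_unit unit_speed Iu; rewrite [(_, _).1]/= [(_, _).2]/=.
(* By unit speed [D x u * current 1 u - D y u * current 0 u] is [- D E u], which cancels the
   derivative of the term [E]; the identity [T] is inserted with factor [D E u]. *)
rewrite -[RHS]addr0 -(mul0r (D E u)) -(subrr 1) -{2}T; ring.
Qed.

(** The left-hand function is the first variation of [L ds] under the displacement [a T + b N], as
    [delta_density] shows; [- K u * b u * Lj u] is the effect of the normal part on arc length. *)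
Lemma exact_congr_density p q a b : flat I p q a -> flat I p q b ->
  exact_congr I x y p q
    (fun u => D (fun u => a u * Lj u) u
      + \sum_(m < n.+1) dL L x y m u * normal_jet x y b m u - K u * b u * Lj u)
    (fun u => b u * EL L x y u).
Proof.
move=> za zb; have sE := smooth_on_euler_op.
refine (@exact_congr_trans R I oI x y unit_speed p q (fun u =>
    \sum_(m < n.+1) ((-1) ^+ m * iter m D (dL L x y m) u * normal_jet x y b 0 u
      + \sum_(0 <= j < m) (-1) ^+ j * iter j D (dL L x y m) u * kap (m - j) u
        * (K u * b u)) - K u * b u * Lj u) _ _ _ _).
  refine (@exact_congr_trans R I oI x y unit_speed p q (fun u =>
      0 + \sum_(m < n.+1) dL L x y m u * normal_jet x y b m u - K u * b u * Lj u) _ _ _ _).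
    apply: (exact_congrD oI unit_speed); last exact: exact_congr_eq.
    apply: (exact_congrD oI unit_speed); last exact: exact_congr_eq.
    (* Tangential displacement contributes an exact term, discarded here. *)
    exists (fun u => a u * Lj u); split; last by move=> u _; rewrite add0r.
    case: za => sa za; split; first exact: (smooth_onM oI sa smooth_on_Lagrangian).
    by move=> u Iu nu; rewrite za// mul0r.
  apply: (exact_congrD oI unit_speed); last exact: exact_congr_eq.
  refine (@exact_congr_trans R I oI x y unit_speed p q (fun u =>
      \sum_(m < n.+1) dL L x y m u * normal_jet x y b m u) _ _ _ _).
    by apply: exact_congr_eq => // u _; rewrite add0r.
  apply: (exact_congr_sum oI unit_speed) => m.
  by apply: exact_congr_normal_jet => //; exact: smooth_on_dL.
refine (@exact_congr_trans R I oI x y unit_speed p q (fun u =>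
    E u * D (D b) u + (K u ^+ 2 * b u * E u
      + K u * b u * double_sum L x y u - K u * b u * Lj u)) _ _ _ _).
  apply: exact_congr_eq => // u _.
  rewrite big_split /= -mulr_suml double_sumE.
  under [X in _ + X - _]eq_bigr => m _ do rewrite -mulr_suml.
  by rewrite -mulr_suml /euler_op; ring.
refine (@exact_congr_trans R I oI x y unit_speed p q (fun u =>
    b u * D (D E) u + (K u ^+ 2 * b u * E u
      + K u * b u * double_sum L x y u - K u * b u * Lj u)) _ _ _ _).
  (* Two integrations by parts move both derivatives from [b] onto [E]. *)
  apply: (exact_congrD oI unit_speed); last exact: exact_congr_eq.
  apply: (exact_congr_trans oI unit_speed).
    by apply: (exact_congr_parts oI unit_speed sE); exact: flat_Ds.
  apply: (@exact_congr_trans R I oI x y unit_speed p q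
      (fun u => - (- (D (D E) u * b u)))).
    apply: (exact_congrN oI unit_speed).
    by apply: (exact_congr_parts oI unit_speed _ zb); exact: smooth_D.
  by apply: exact_congr_eq => // u _; rewrite opprK mulrC.
by apply: exact_congr_eq => // u _; rewrite /EL; ring.
Qed.

End EulerLagrange.

(** * First variation *)

Lemma open_strip (R : realType) (I : set R) (d : R) : open I ->
  open (I `*` [set e : R | `|e| < d]).
Proof.
move=> oI; have -> : [set e : R | `|e| < d] = ball (0 : R) d.
  by apply/seteqP; split=> e; rewrite /ball/= sub0r normrN.
rewrite openE => -[u e] [/= Iu de]; exists (I, ball (0 : R) d) => /=.
  split; apply: open_nbhs_nbhs; split=> //; exact: ball_open.
by move=> [v f] [].
Qed.

Section FirstVariation.
Context {R : realType}.
Variables (n : nat) (L : 'rV[R]_n.+1 -> R).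
Hypothesis sL : smooth_on [set: 'rV[R]_n.+1] L.
Variables (I : set R) (oI : open I) (x y : R -> R).
Hypotheses (sx : smooth_on I x) (sy : smooth_on I y).
Hypothesis unit_speed : forall s, I s -> derive1 x s ^+ 2 + derive1 y s ^+ 2 = 1.
Variables (p q d : R) (X Y : R * R -> R).
Hypotheses (pqI : `[p, q] `<=` I) (d0 : 0 < d).
Hypotheses (vX : compact_variation I p q d x X).
Hypotheses (vY : compact_variation I p q d y Y).
Implicit Types (f g : R * R -> R) (u : R).

Local Notation D := (Ds x y).
Local Notation K := (curvature x y).
Local Notation kap := (kappa x y).
Local Notation U := (I `*` [set e : R | `|e| < d]).
Local Notation W := (regular U X Y).
Local Notation delta f := (fun u => De f (u, 0)).

Let sX : smooth_on U X. Proof. by case: vX. Qed.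
Let sY : smooth_on U Y. Proof. by case: vY. Qed.

Let oU : open U. Proof. exact: open_strip. Qed.

Let oW : open W. Proof. exact: open_regular. Qed.

Let U0 u : I u -> U (u, 0). Proof. by move=> Iu; split=> //=; rewrite normr0. Qed.

Let Du0 (z : R -> R) f u : (forall u, I u -> f (u, 0) = z u) -> I u ->
  Du f (u, 0) = D z u.
Proof.
move=> fz Iu; rewrite -derive1_slice (Ds_derive1 unit_speed)// !derive1E.
by apply: near_eq_derive; exact: near_open_eq Iu.
Qed.

Let X0 u : I u -> X (u, 0) = x u. Proof. by case: vX => _ + _; exact. Qed.
Let Y0 u : I u -> Y (u, 0) = y u. Proof. by case: vY => _ + _; exact. Qed.

Let speed0 u : I u -> Du X (u, 0) ^+ 2 + Du Y (u, 0) ^+ 2 = 1.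
Proof. by move=> Iu; rewrite (Du0 X0)// (Du0 Y0)// (tangent_unit unit_speed). Qed.

Let speed2_0 u : I u -> speed2 X Y (u, 0) = 1.
Proof. by move=> Iu; rewrite /speed2 speed0// sqrtr1. Qed.

Let W0 u : I u -> W (u, 0).
Proof. by move=> Iu; split; [exact: U0|rewrite speed0]. Qed.

Let Ds2_0 f u : I u -> Ds2 X Y f (u, 0) = D (fun u => f (u, 0)) u.
Proof. by move=> Iu; rewrite /Ds2 speed2_0// divr1; exact: Du0. Qed.

(* Unification otherwise unfolds derivatives down to limits of filters. *)
Opaque Du De Ds2 speed2 Ds.

Let kappa2_0 m u : I u -> kappa2 X Y m (u, 0) = kap m u.
Proof.
elim: m u => [|m IH] u Iu /=; last first.
  by rewrite Ds2_0//; exact: (eq_Ds oI unit_speed IH Iu).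
have eX s : I s -> Ds2 X Y X (s, 0) = D x s.
  by move=> Is; rewrite Ds2_0//; exact: (eq_Ds oI unit_speed X0 Is).
have eY s : I s -> Ds2 X Y Y (s, 0) = D y s.
  by move=> Is; rewrite Ds2_0//; exact: (eq_Ds oI unit_speed Y0 Is).
have E4 (a b c e a' b' c' e' : R) : a = a' -> b = b' -> c = c' -> e = e' ->
  a * b - c * e = a' * b' - c' * e' by move=> -> -> -> ->.
exact: (E4 _ _ _ _ _ _ _ _ (eX u Iu)
  (etrans (Ds2_0 (Ds2 X Y Y) Iu) (eq_Ds oI unit_speed eY Iu)) (eY u Iu)
  (etrans (Ds2_0 (Ds2 X Y X) Iu) (eq_Ds oI unit_speed eX Iu))).
Qed.

Let flat_delta (z : R -> R) f : compact_variation I p q d z f ->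
  flat I p q (delta f).
Proof.
move=> [sf _ f0]; split.
  by apply: (smooth_on_slice oI U0); exact: smooth_on_De.
move=> u Iu nu; rewrite (De_slice sf (U0 Iu)).
apply: etrans (derive_cst (z u) (0 : R) (1 : R)); apply: near_eq_derive.
have := nbhsx_ballx (0 : R) d d0; apply: filterS => e.
by rewrite /ball/= sub0r normrN => ed; rewrite f0.
Qed.

Let xi : R -> R := delta X.
Let eta : R -> R := delta Y.
Let fxi : flat I p q xi := flat_delta vX.
Let feta : flat I p q eta := flat_delta vY.

(* With [T] and [N] the unit tangent and normal, the variation field is
   [tang * T + norm * N] and its derivative is [sigma * T + nu * N]. *)
Let tang u : R := D x u * xi u + D y u * eta u.
Let norm u : R := D x u * eta u - D y u * xi u.
Let sigma u : R := D tang u - K u * norm u.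
Let nu u : R := D norm u + K u * tang u.

Let smDx : smooth_on I (D x). Proof. exact: smooth_on_Ds. Qed.
Let smDy : smooth_on I (D y). Proof. exact: smooth_on_Ds. Qed.
Let smK : smooth_on I K. Proof. exact: smooth_on_curvature. Qed.

Let ftang : flat I p q tang.
Proof. by apply: flatD => //; exact: flatM. Qed.

Let fnorm : flat I p q norm.
Proof. by apply: flatD => //; [exact: flatM|apply: flatN => //; exact: flatM]. Qed.

Let smtang : smooth_on I tang. Proof. by case: ftang. Qed.
Let smnorm : smooth_on I norm. Proof. by case: fnorm. Qed.
Let smnu : smooth_on I nu.
Proof. by apply: smooth_onD => //; [exact: smooth_on_Ds|exact: smooth_onM]. Qed.

Let Dxi u : I u -> D xi u = sigma u * D x u - nu u * D y u.
Proof.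
move=> Iu; have [T1 T2] := frenet oI sx sy unit_speed Iu.
have -> : D xi u = D (fun u => tang u * D x u - norm u * D y u) u.
  apply: (eq_Ds oI unit_speed _ Iu) => s Is.
  rewrite -[LHS]mulr1 -(tangent_unit unit_speed Is) /tang /norm; ring.
rewrite (DsB oI unit_speed)//; try exact: smooth_onM.
rewrite (DsM unit_speed smtang smDx Iu) (DsM unit_speed smnorm smDy Iu).
by rewrite T1 T2 /sigma /nu; ring.
Qed.

Let Deta u : I u -> D eta u = sigma u * D y u + nu u * D x u.
Proof.
move=> Iu; have [T1 T2] := frenet oI sx sy unit_speed Iu.
have -> : D eta u = D (fun u => tang u * D y u + norm u * D x u) u.
  apply: (eq_Ds oI unit_speed _ Iu) => s Is.
  rewrite -[LHS]mulr1 -(tangent_unit unit_speed Is) /tang /norm; ring.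
rewrite (DsD unit_speed)//; try exact: smooth_onM.
rewrite (DsM unit_speed smtang smDy Iu) (DsM unit_speed smnorm smDx Iu).
by rewrite T1 T2 /sigma /nu; ring.
Qed.

(** To first order, length changes only through the tangential component of the derivative of the
    variation field. *)
Let delta_speed u : I u -> De (speed2 X Y) (u, 0) = sigma u.
Proof.
move=> Iu; rewrite (De_speed2 oU sX sY (W0 Iu) (speed2_0 Iu)).
rewrite (Du0 X0)// (Du0 Y0)// (Du0 (z := xi))// (Du0 (z := eta))//.
rewrite Dxi// Deta// -[RHS]mulr1 -(tangent_unit unit_speed Iu); ring.
Qed.

(* The last term is the commutator of the variation with [d/ds]. *)
Let delta_Ds2 f (z : R -> R) u : smooth_on W f ->
  (forall u, I u -> f (u, 0) = z u) -> I u ->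
  De (Ds2 X Y f) (u, 0) = D (delta f) u - sigma u * D z u.
Proof.
move=> sf fz Iu; rewrite (De_Ds2 oU sX sY sf (W0 Iu) (speed2_0 Iu)).
by rewrite delta_speed// (Du0 fz)// (Du0 (z := delta f)).
Qed.

Let rX : smooth_on W X. Proof. exact: sub_regular. Qed.
Let rY : smooth_on W Y. Proof. exact: sub_regular. Qed.
Let rDX : smooth_on W (Ds2 X Y X). Proof. exact: smooth_on_Ds2. Qed.
Let rDY : smooth_on W (Ds2 X Y Y). Proof. exact: smooth_on_Ds2. Qed.

Let DsX0 u : I u -> Ds2 X Y X (u, 0) = D x u.
Proof. by move=> Iu; rewrite Ds2_0//; exact: (eq_Ds oI unit_speed X0 Iu). Qed.

Let DsY0 u : I u -> Ds2 X Y Y (u, 0) = D y u.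
Proof. by move=> Iu; rewrite Ds2_0//; exact: (eq_Ds oI unit_speed Y0 Iu). Qed.

(** The unit tangent can only rotate, at rate [nu u]: the commutator removes the [sigma u] part of
    [Dxi]. *)
Let delta_DX u : I u -> De (Ds2 X Y X) (u, 0) = - (nu u * D y u).
Proof. by move=> Iu; rewrite (delta_Ds2 rX X0 Iu) Dxi//; ring. Qed.

Let delta_DY u : I u -> De (Ds2 X Y Y) (u, 0) = nu u * D x u.
Proof. by move=> Iu; rewrite (delta_Ds2 rY Y0 Iu) Deta//; ring. Qed.

Let delta_DDX u : I u -> De (Ds2 X Y (Ds2 X Y X)) (u, 0) =
  - (D nu u * D y u + nu u * (K u * D x u)) + sigma u * K u * D y u.
Proof.
move=> Iu; have [T1 T2] := frenet oI sx sy unit_speed Iu.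
rewrite (delta_Ds2 rDX DsX0 Iu) T1 (eq_Ds oI unit_speed delta_DX Iu).
rewrite (DsN unit_speed)//; last exact: smooth_onM.
by rewrite (DsM unit_speed)// T2; ring.
Qed.

Let delta_DDY u : I u -> De (Ds2 X Y (Ds2 X Y Y)) (u, 0) =
  D nu u * D x u - nu u * (K u * D y u) - sigma u * K u * D x u.
Proof.
move=> Iu; have [T1 T2] := frenet oI sx sy unit_speed Iu.
rewrite (delta_Ds2 rDY DsY0 Iu) T2 (eq_Ds oI unit_speed delta_DY Iu).
by rewrite (DsM unit_speed)// T1; ring.
Qed.

(** At level 0 the curvature varies by [D nu u - sigma u * K u]. At each further level the
    commutator cancels [D tang u * kap m.+1 u] and leaves the summand [K u * norm u * kap m.+1 u]
    recorded by [normal_jet]. *)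
Let delta_kappa m u : I u -> De (kappa2 X Y m) (u, 0) =
  tang u * kap m.+1 u + normal_jet x y norm m u.
Proof.
have rkap m' : smooth_on W (kappa2 X Y m') by exact: smooth_on_kappa2.
elim: m u => [|m IH] u Iu; last first.
  rewrite (delta_Ds2 (rkap m) (kappa2_0 m) Iu) (eq_Ds oI unit_speed IH Iu).
  have sk := smooth_on_kappa oI sx sy unit_speed m.+1.
  have [sg _] := flat_normal_jet oI sx sy unit_speed m fnorm.
  rewrite (DsD unit_speed)//; last exact: smooth_onM.
  by rewrite (DsM unit_speed)// /sigma /=; ring.
have [T1 T2] := frenet oI sx sy unit_speed Iu.
have rDDX : smooth_on W (Ds2 X Y (Ds2 X Y X)) by exact: smooth_on_Ds2.
have rDDY : smooth_on W (Ds2 X Y (Ds2 X Y Y)) by exact: smooth_on_Ds2.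
have r1 := smooth_onM oW rDX rDDY; have r2 := smooth_onM oW rDY rDDX.
have E4 (a b c e a' b' c' e' : R) : a = a' -> b = b' -> c = c' -> e = e' ->
  a * b + c * e = a' * b' + c' * e' by move=> -> -> -> ->.
have DDX0 : Ds2 X Y (Ds2 X Y X) (u, 0) = - (K u * D y u).
  by apply: etrans (Ds2_0 _ Iu) _; apply: etrans (eq_Ds oI unit_speed DsX0 Iu) T1.
have DDY0 : Ds2 X Y (Ds2 X Y Y) (u, 0) = K u * D x u.
  by apply: etrans (Ds2_0 _ Iu) _; apply: etrans (eq_Ds oI unit_speed DsY0 Iu) T2.
have e1 := etrans (DeM rDX rDDY (W0 Iu))
  (E4 _ _ _ _ _ _ _ _ (DsX0 Iu) (delta_DDY Iu) DDY0 (delta_DX Iu)).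
have e2 := etrans (DeM rDY rDDX (W0 Iu))
  (E4 _ _ _ _ _ _ _ _ (DsY0 Iu) (delta_DDX Iu) DDX0 (delta_DY Iu)).
apply: etrans (etrans (DeB r1 r2 (W0 Iu)) (congr2 (fun a b => a - b) e1 e2)) _.
have Dnu : D nu u = D (D norm) u + (D K u * tang u + K u * D tang u).
  have sDnorm := smooth_on_Ds oI unit_speed smnorm.
  have := DsD unit_speed sDnorm (smooth_onM oI smK smtang) Iu.
  by rewrite (DsM unit_speed smK smtang Iu).
have -> : tang u * D K u + (D (D norm) u + K u ^+ 2 * norm u) =
    (D nu u - sigma u * K u) * (D x u ^+ 2 + D y u ^+ 2).
  by rewrite (tangent_unit unit_speed Iu) Dnu /sigma; ring.
ring.
Qed.

(** The terms in [tang u] add up to [tang u] times the derivative of [L] along the curve; together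
    with [D tang u] from the speed they form one total derivative. *)
Let delta_density u : I u -> De (density L X Y) (u, 0) =
  D (fun u => tang u * L (kappa_jet n x y u)) u
  + \sum_m dL L x y m u * normal_jet x y norm m u
  - K u * norm u * L (kappa_jet n x y u).
Proof.
move=> Iu; have sLj := smooth_on_Lagrangian sL oI sx sy unit_speed.
have rs : smooth_on W (speed2 X Y) by exact: smooth_on_speed2.
have jet0 : \row_(m < n.+1) kappa2 X Y m (u, 0) = kappa_jet n x y u.
  by apply/rowP => m; rewrite !mxE kappa2_0.
have sk (m : 'I_n.+1) : smooth_on W (kappa2 X Y m) by exact: smooth_on_kappa2.
have sLk : smooth_on W (fun a => L (\row_(m < n.+1) kappa2 X Y m a)).
  apply: (smooth_on_chain oW sL) => m.
  by apply: (eq_smooth_on oW _ (sk m)) => a _; rewrite mxE.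
apply: etrans (DeM sLk rs (W0 Iu)) _.
rewrite (De_chain sL sk (W0 Iu)).
rewrite jet0 speed2_0// delta_speed// mul1r.
rewrite (DsM unit_speed)// (Ds_Lagrangian sL oI sx sy unit_speed Iu).
under eq_bigr => m _ do rewrite delta_kappa// mulrDr mulrCA.
rewrite big_split /= -mulr_sumr /sigma -!/(dL _ _ _ _ _).
by rewrite -/tang /dL; ring.
Qed.

(** Valid on every unit speed curve, extremal or not: both directions of the Euler-Lagrange
    equivalence and the identification of the currents rest on it. *)
Lemma first_variation : is_derive (0 : R) 1
  (fun e => action L p q (fun u => X (u, e)) (fun u => Y (u, e)))
  (\int[lebesgue_measure]_(u in `[p, q])
    ((D x u * De Y (u, 0) - D y u * De X (u, 0)) * EL L x y u)).
Proof.
have -> : (fun e => action L p q (fun u => X (u, e)) (fun u => Y (u, e))) =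
    (fun e => \int[lebesgue_measure]_(u in `[p, q]) density L X Y (u, e)).
  by apply/funext => e; rewrite action_slice.
have [pq|qp] := ltP p q; last first.
  rewrite Rintegral_itv_ge//; under eq_fun do rewrite Rintegral_itv_ge//.
  exact: is_derive_cst.
have sW : smooth_on W (density L X Y) by exact: smooth_on_density.
have := is_derive_under_Rintegral oW sW (fun u upq => W0 (pqI upq)).
congr is_derive; rewrite -/De.
apply: (Rintegral_exact_congr oI unit_speed _ pqI pq).
  apply: smooth_onM => //.
  exact: smooth_on_EL.
apply: (exact_congr_trans oI unit_speed
  (exact_congr_eq oI unit_speed _ _ delta_density)).
exact: (exact_congr_density sL oI sx sy unit_speed ftang fnorm).
Qed.

End FirstVariation.

(** A deformation linear in [e] realizes any prescribed smooth field vanishing outside the segment;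
    the width 1 is arbitrary. *)
Lemma affine_variation (R : realType) (I : set R) (p q : R) (z w : R -> R) :
  open I -> smooth_on I z -> smooth_on I w ->
  (forall u, I u -> ~ `[p, q]%classic u -> w u = 0) ->
  compact_variation I p q 1 z (fun a => z a.1 + a.2 * w a.1) /\
  (forall u, I u -> De (fun a => z a.1 + a.2 * w a.1) (u, 0) = w u).
Proof.
move=> oI sz sw w0.
set U := I `*` [set e : R | `|e| < 1].
have oU : open U by exact: open_strip.
have sfst f : smooth_on I f -> smooth_on U (fun a => f a.1).
  move=> sf; apply: (smooth_on_comp oU _ sf); first by move=> a [].
  exact: smooth_on_fst.
have sX : smooth_on U (fun a => z a.1 + a.2 * w a.1).
  apply: smooth_onD => //; first exact: sfst.
  by apply: smooth_onM => //; [exact: smooth_on_snd|exact: sfst].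
split.
  split=> [//|u Iu|u e Iu nu _] /=; first by rewrite mul0r addr0.
  by rewrite w0// mulr0 addr0.
move=> u Iu; rewrite (De_slice sX); last by split; rewrite //= normr0.
have -> : (fun e : R => z (u, e).1 + (u, e).2 * w (u, e).1) =
    (fun e : R => e *: w u + z u) by apply/funext => e /=; rewrite addrC.
by case: (is_derive_scale_line (w u) (z u)).
Qed.

Lemma eq_is_derive (R : realType) (f g : R -> R) (t df dg : R) :
  f =1 g -> df = dg -> is_derive t 1 f df -> is_derive t 1 g dg.
Proof. by move=> /funext -> ->. Qed.

(** * Euler-Lagrange equivalence and conservation laws *)

Section Noether.
Context {R : realType}.
Variables (n : nat) (L : 'rV[R]_n.+1 -> R).
Hypothesis sL : smooth_on [set: 'rV[R]_n.+1] L.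
Variables (I : set R) (oI : open I) (x y : R -> R).
Hypotheses (sx : smooth_on I x) (sy : smooth_on I y).
Hypothesis unit_speed : forall s, I s -> derive1 x s ^+ 2 + derive1 y s ^+ 2 = 1.

Local Notation D := (Ds x y).

Lemma EL_extremal : (forall s, I s -> EL L x y s = 0) -> extremal L I x y.
Proof.
move=> EL0 p q d X Y pqI d0 vX vY.
apply: eq_is_derive (first_variation sL oI sx sy unit_speed pqI d0 vX vY) => //.
rewrite (_ : \int[_]_(u in _) _ =
  \int[lebesgue_measure]_(u in `[p, q]) (cst (0 : R)) u).
  by rewrite Rintegral_cst// mul0r.
by apply: eq_Rintegral => u /set_mem/pqI Iu; rewrite EL0// mulr0.
Qed.

Lemma extremal_EL : extremal L I x y -> forall s, I s -> EL L x y s = 0.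
Proof.
move=> ext s Is.
have sEL := smooth_on_EL sL oI sx sy unit_speed.
have : nbhs s I by exact: open_nbhs_nbhs.
move=> /nbhs_ballP[r /= r0 rI].
pose p := s - r / 2; pose q := s + r / 2.
have pqI : `[p, q] `<=` I.
  move=> u; rewrite /= in_itv/= => /andP[pu uq]; apply: rI.
  by rewrite /ball/= ltr_norml; apply/andP; split; rewrite /p /q in pu uq; lra.
have [chi [schi chi0 chiN0]] := exists_bump p q.
have schiI : smooth_on I chi by apply: sub_smooth_on schi.
pose b u := chi u * (chi u * EL L x y u).
have sb : smooth_on I b by do ?apply: smooth_onM => //.
have b0 u : I u -> ~ `[p, q]%classic u -> b u = 0.
  by move=> _ /chi0; rewrite /b => ->; rewrite mul0r.
have sDx := smooth_on_Ds oI unit_speed sx.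
have sDy := smooth_on_Ds oI unit_speed sy.
(* The displacement is [b] times the unit normal, whose coordinates are [- D y] and [D x], so its
   normal component is [b]. *)
have [vX dX] := @affine_variation R I p q x (fun u => - (b u * D y u)) oI sx
  (smooth_onN oI (smooth_onM oI sb sDy))
  (fun u Iu nu => etrans (congr1 (fun t => - (t * D y u)) (b0 u Iu nu))
    (etrans (congr1 -%R (mul0r _)) (oppr0 _))).
have [vY dY] := @affine_variation R I p q y (fun u => b u * D x u) oI sy
  (smooth_onM oI sb sDx)
  (fun u Iu nu => etrans (congr1 (fun t => t * D x u) (b0 u Iu nu)) (mul0r _)).
have [_ d1] := first_variation sL oI sx sy unit_speed pqI ltr01 vX vY.
have [_ d2] := ext p q 1 _ _ pqI ltr01 vX vY.
(* Extremality gives the derivative 0 and the first variation formula gives this integral; a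
   derivative has one value. *)
have : \int[lebesgue_measure]_(u in `[p, q]) (chi u * EL L x y u) ^+ 2 = 0.
  rewrite -[RHS]d2 d1; apply: eq_Rintegral => u /set_mem/pqI Iu.
  rewrite dX// dY// -[LHS]mul1r -(tangent_unit unit_speed Iu) /b; ring.
move=> /(@Rintegral_eq0_continuous R I _ p q) -/(_ _ pqI _ s).
have /[swap] /[apply] : forall u, I u ->
    {for u, continuous (fun u => (chi u * EL L x y u) ^+ 2)}.
  move=> u; apply: smooth_on_continuous.
  by apply: smooth_onX => //; exact: smooth_onM.
have /[swap] /[apply] : forall u, I u -> 0 <= (chi u * EL L x y u) ^+ 2.
  by move=> u _; exact: sqr_ge0.
have ps : p < s < q by apply/andP; split; rewrite /p /q; lra.
move=> /(_ ps)/eqP; rewrite expf_eq0 mulf_eq0 (negbTE (chiN0 _ ps)) /=.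
by move=> /eqP.
Qed.

Lemma noether_current_se2 (i : 'I_3) :
  noether_current L I x y (@se2_generator R i) (current L x y i).
Proof.
move=> p q chi pqI schi chi0.
set v := fun u => se2_generator i (x u) (y u).
have schiI : smooth_on I chi by apply: sub_smooth_on schi.
have [sv1 sv2] : smooth_on I (fun u => (v u).1) /\ smooth_on I (fun u => (v u).2).
  rewrite /v; case: i v => [[|[|[|//]]] i] v; split;
    (exact: smooth_on_cst) || (exact: smooth_onN) || assumption.
pose w1 u := chi u * (v u).1; pose w2 u := chi u * (v u).2.
have sw1 : smooth_on I w1 by exact: smooth_onM.
have sw2 : smooth_on I w2 by exact: smooth_onM.
have w10 u : I u -> ~ `[p, q]%classic u -> w1 u = 0.
  by move=> _ /chi0; rewrite /w1 => ->; rewrite mul0r.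
have w20 u : I u -> ~ `[p, q]%classic u -> w2 u = 0.
  by move=> _ /chi0; rewrite /w2 => ->; rewrite mul0r.
have [vX dX] := affine_variation oI sx sw1 w10.
have [vY dY] := affine_variation oI sy sw2 w20.
apply: eq_is_derive (first_variation sL oI sx sy unit_speed pqI ltr01 vX vY).
  move=> e; apply: (congr2 (action L p q)); apply/funext => u /=;
    by rewrite /w1 /w2 mulrA.
have sc := smooth_on_current sL oI sx sy unit_speed i.
have [pq|qp] := ltP p q; last first.
  by rewrite !Rintegral_itv_ge.
apply/esym; apply: (Rintegral_exact_congr oI unit_speed _ pqI pq).
  have sEL := smooth_on_EL sL oI sx sy unit_speed.
  apply: smooth_onM => //.
  have sDx := smooth_on_Ds oI unit_speed sx.
  have sDy := smooth_on_Ds oI unit_speed sy.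
  apply: (eq_smooth_on oI _ (smooth_onB oI (smooth_onM oI sDx sw2)
    (smooth_onM oI sDy sw1))) => u Iu.
  by rewrite dX// dY.
exists (fun u => chi u * current L x y i u); split.
  split; first exact: smooth_onM.
  by move=> u _ /chi0 ->; rewrite mul0r.
move=> u Iu; rewrite (DsM unit_speed schiI sc Iu).
rewrite (Ds_current sL oI sx sy unit_speed i Iu) dX// dY//.
by rewrite -(Ds_derive1 unit_speed)// /w1 /w2 -/(v u); ring.
Qed.

(** The mean value theorem compares two points through the segment between them, which [is_interval]
    places inside [I]. *)
Lemma EL_current_constant (i : 'I_3) : is_interval I ->
  (forall s, I s -> EL L x y s = 0) ->
  forall s t, I s -> I t -> current L x y i s = current L x y i t.
Proof.
move=> iI EL0.
have sc := smooth_on_current sL oI sx sy unit_speed i.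
suff H s t : s <= t -> I s -> I t -> current L x y i s = current L x y i t.
  move=> s t Is It; have [st|/ltW ts] := leP s t; first exact: H.
  by rewrite (H t s).
move=> st Is It.
have stI u : u \in `[s, t] -> I u.
  by rewrite in_itv/= => /andP[su ut]; apply: (iI s t) => //; rewrite su ut.
have Hd u : u \in `[s, t] -> is_derive u 1 (current L x y i) 0.
  move=> /stI Iu; have := Ds_is_derive unit_speed sc Iu.
  by rewrite (Ds_current sL oI sx sy unit_speed i Iu) EL0// mulr0 oppr0.
move: (current L x y i) Hd => f Hd.
have Hd' u : u \in `]s, t[ -> is_derive u 1 f 0.
  by move=> ust; apply: Hd; exact: subset_itv_oo_cc.
have cf : {within `[s, t], continuous f}.
  by apply: derivable_within_continuous => u /Hd[].
have [c _ E] := MVT_segment st Hd' cf.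
by move: E => /eqP; rewrite mul0r subr_eq0 => /eqP.
Qed.

End Noether.

Theorem mainTheorem1 (R : realType) (n : nat) (L : 'rV[R]_n.+1 -> R)
    (hL : smooth_on [set: 'rV[R]_n.+1] L)
    (I : set R) (oI : open I) (iI : is_interval I)
    (x y : R -> R) (hx : smooth_on I x) (hy : smooth_on I y)
    (hxy : forall s, I s -> derive1 x s ^+ 2 + derive1 y s ^+ 2 = 1) :
  (extremal L I x y <-> forall s, I s -> EL L x y s = 0) /\
  (forall i : 'I_3, noether_current L I x y (@se2_generator R i)
     (fun s => (noether_matrix x y s *m noether_vector L x y s) i 0)) /\
  (extremal L I x y ->
     exists c : 'cV[R]_3, forall s, I s ->
       noether_matrix x y s *m noether_vector L x y s = c).
Proof.
split; first by split; [exact: extremal_EL|exact: EL_extremal].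
split; first by move=> i; exact: noether_current_se2.
move=> /(extremal_EL hL oI hx hy hxy) EL0.
(* [I] may be empty, and then any vector serves; otherwise the value at one point is the
   constant. *)
have [[s0 Is0]|nI] := pselect (exists s, I s); last first.
  by exists 0 => s Is; case: nI; exists s.
exists (noether_matrix x y s0 *m noether_vector L x y s0) => s Is.
apply/colP => i; exact: (EL_current_constant hL oI hx hy hxy i iI EL0 Is Is0).
Qed.
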